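(* Let $(\overline E,\overline X(0),\overline\nu_0)\in\mathcal S_0$ and suppose the hazard rate $h$ is continuous on $[0,M)$. Then there exists at most one solution $(\overline X,\overline\nu)$ to the fluid equations associated with $(\overline E,\overline X(0),\overline\nu_0)$ and $h$. Moreover, the solution $(\overline X,\overline\nu)$ satisfies, for every bounded continuous $f:\mathbb R_+\to\mathbb R$ and every $t\in[0,\infty)$, $$\int_{[0,M)} f(x)\,\overline\nu_t(dx)=\int_{[0,M)} f(x+t)\frac{1-G(x+t)}{1-G(x)}\,\overline\nu_0(dx)+\int_0^t f(t-s)(1-G(t-s))\,d\overline K(s),$$ where $\overline K(t)=\langle \mathbf 1,\overline\nu_t\rangle-\langle\mathbf 1,\overline\nu_0\rangle+\int_0^t\langle h,\overline\nu_s\rangle\,ds$. Moreover, if $\overline E$ is absolutely continuous with $\overline\lambda\doteq d\overline E/dt$, then $\overline K$ is also absolutely continuous and $\overline\kappa\doteq d\overline K/dt$ satisfies, for a.e. $t\in[0,\infty)$, $$\overline\kappa(t)=\begin{cases}\overline\lambda(t)&\text{if }\overline X(t)<1,\\ \overline\lambda(t)\wedge\langle h,\overline\nu_t\rangle&\text{if }\overline X(t)=1,\\ \langle h,\overline\nu_t\rangle&\text{if }\overline X(t)>1.\end{cases}$$ Furthermore, if $\overline\nu_0$ and $\overline E$ are absolutely continuous, then $\overline\nu_s$ is absolutely continuous for every $s\in[0,\infty)$.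
   Context: $G$ is a cumulative distribution function on $[0,\infty)$ with density $g$ and mean $1$, i.e. $\int_0^\infty(1-G(x))\,dx=1$. Set $M\doteq\sup\{x\in[0,\infty):G(x)<1\}\in(0,\infty]$ and let $h(x)\doteq g(x)/(1-G(x))$, $x\in[0,M)$, be the hazard rate. $\mathbb R_+=[0,\infty)$; $\mathbf 1$ is the constant function $1$; $\langle f,\xi\rangle\doteq\int_{[0,M)}f(x)\,\xi(dx)$; $a^+=\max(a,0)$. $\mathcal M_{\le1}[0,M)$ is the space of (non-negative Borel) sub-probability measures on $[0,M)$ with the weak topology. A measure is absolutely continuous if it is so with respect to Lebesgue measure. $\mathcal I_{\mathbb R_+}[0,\infty)$ is the set of non-decreasing càdlàg $f:[0,\infty)\to\mathbb R_+$ with $f(0)=0$. $$\mathcal S_0\doteq\{(f,x,\mu)\in\mathcal I_{\mathbb R_+}[0,\infty)\times\mathbb R_+\times\mathcal M_{\le1}[0,M):\ 1-\langle\mathbf 1,\mu\rangle=[1-x]^+\}.$$ Fluid equations: a càdlàg function $(\overline X,\overline\nu)$ on $[0,\infty)$ with values in $\mathbb R_+\times\mathcal M_{\le1}[0,M)$ solves the fluid equations associated with $(\overline E,\overline X(0),\overline\nu_0)\in\mathcal S_0$ and $h$ if for every $t\ge0$, $\int_0^t\langle h,\overline\nu_s\rangle\,ds<\infty$, and for every continuously differentiable, compactly supported $\varphi$ on $[0,M)\times\mathbb R_+$, $$\langle\varphi(\cdot,t),\overline\nu_t\rangle=\langle\varphi(\cdot,0),\overline\nu_0\rangle+\int_0^t\langle\varphi_s(\cdot,s),\overline\nu_s\rangle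 ds+\int_0^t\langle\varphi_x(\cdot,s),\overline\nu_s\rangle ds-\int_0^t\langle h(\cdot)\varphi(\cdot,s),\overline\nu_s\rangle ds+\int_0^t\varphi(0,s)\,d\overline K(s),$$ $$\overline X(t)=\overline X(0)+\overline E(t)-\int_0^t\langle h,\overline\nu_s\rangle\,ds,\qquad 1-\langle\mathbf 1,\overline\nu_t\rangle=[1-\overline X(t)]^+,$$ where $\overline K(t)=\langle\mathbf 1,\overline\nu_t\rangle-\langle\mathbf 1,\overline\nu_0\rangle+\int_0^t\langle h,\overline\nu_s\rangle\,ds$. Here $\varphi_x,\varphi_s$ are the partial derivatives in the first and second variables, and integrals $\int_0^t\cdots d\overline K(s)$ are Riemann–Stieltjes integrals over $[0,t]$. *)

(* Defs.v *)
From HB Require Import structures.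
From mathcomp Require Import all_boot all_order all_algebra.
From mathcomp Require Import all_classical all_reals all_analysis.

Set Implicit Arguments.
Unset Strict Implicit.
Unset Printing Implicit Defensive.
Import Order.TTheory GRing.Theory Num.Theory.
Import numFieldNormedType.Exports.

Local Open Scope classical_set_scope.
Local Open Scope ring_scope.

(* Functions on [0, oo) are total functions on R whose values at negative
   arguments are never used.  The state space [0, M) is passed around as a set
   [D] of reals, and a measure on [0, M) is a Borel measure on R that vanishes
   outside [D]. *)

Section service_distribution.
Context {R : realType}.
Notation mu := (@lebesgue_measure R).

Definition half_line : set R := [set x | 0 <= x].

(* [cumulativeBounded 0 1] says that G is a distribution function on R;
   vanishing on the negative half-line makes it one on [0, oo). *)
Record cdf_with_density (G : cumulativeBounded (0 : R) (1 : R)) (g : R -> R)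
    : Prop := {
  cdf_neg : forall x, x < 0 -> G x = 0 ;
  density_measurable : measurable_fun half_line g ;
  density_ge0 : forall x, 0 <= x -> 0 <= g x ;
  density_cdf : forall x, 0 <= x ->
    (G x)%:E = (\int[mu]_(y in `[0%R, x]) (g y)%:E)%E }.

Definition mean_one (G : R -> R) : Prop :=
  (\int[mu]_(x in half_line) (1 - G x)%:E = 1)%E.

Definition right_end (G : R -> R) : \bar R :=
  ereal_sup [set x%:E | x in [set x : R | 0 <= x /\ G x < 1]].

Definition service_itv (G : R -> R) : set R :=
  [set x | 0 <= x /\ (x%:E < right_end G)%E].

Definition hazard (G g : R -> R) (x : R) : R := g x / (1 - G x).

End service_distribution.

Section paths.
Context {R : realType}.
Implicit Types (f k E : R -> R).

Definition cadlag f : Prop :=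
  (forall t, 0 <= t -> f s @[s --> t^'+] --> f t) /\
  (forall t, 0 < t -> exists l : R, f s @[s --> t^'-] --> l).

Definition increasing_cadlag E : Prop :=
  [/\ cadlag E, (forall t, 0 <= t -> 0 <= E t),
      (forall s t, 0 <= s -> s <= t -> E s <= E t) & E 0 = 0].

(* Absolute continuity of a function on [0, oo): the epsilon-delta condition
   on each compact [0, T]. *)
Definition absolutely_continuous_on (T : R) f : Prop :=
  forall e : R, 0 < e -> exists2 d : R, 0 < d &
    forall (n : nat) (a b : 'I_n -> R),
      (forall i, [/\ 0 <= a i, a i <= b i & b i <= T]) ->
      trivIset setT (fun i => [set` `]a i, b i[]) ->
      \sum_(i < n) (b i - a i) < d ->
      \sum_(i < n) `|f (b i) - f (a i)| < e.

Definition absolutely_continuous f : Prop :=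
  forall T, 0 <= T -> absolutely_continuous_on T f.

(* A partition of [a, b] with points a = x_0 < x_1 < ... < x_n = b is given by
   the sequence s = [:: x_1; ...; x_n], as in [itv_partition]; [c i] is the
   tag in [x_i, x_(i+1)]. *)
Definition RS_sum f k (a b : R) (s : seq R) (c : nat -> R) : R :=
  \sum_(i < size s) f (c i) * (k (nth b s i) - k (nth b (a :: s) i)).

Definition is_RS_integral f k (a b I : R) : Prop :=
  forall e : R, 0 < e -> exists2 d : R, 0 < d &
    forall (s : seq R) (c : nat -> R), itv_partition a b s ->
      (forall i, (i < size s)%N ->
         [/\ nth b (a :: s) i <= c i, c i <= nth b s i &
             nth b s i - nth b (a :: s) i < d]) ->
      `|RS_sum f k a b s c - I| < e.

End paths.

Section measures.
Context {R : realType}.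
Notation submeasure := (subprobability (measurableTypeR R) R).
Implicit Types (D : set R) (xi : submeasure) (nu : R -> submeasure).

Definition supported_on D xi : Prop := xi (~` D) = 0%E.

Definition pairing D (f : R -> R) xi : R := \int[xi]_(x in D) f x.

(* For nonnegative f that need not be integrable; the value may be +oo. *)
Definition epairing D (f : R -> R) xi : \bar R :=
  (\int[xi]_(x in D) (f x)%:E)%E.

Definition bounded_continuous_on D (f : R -> R) : Prop :=
  {within D, continuous f} /\
  exists B : R, forall x, D x -> `|f x| <= B.

(* Convergence in the weak topology of measures on [D]: the test functions are
   bounded and continuous on [D] only, so mass cannot escape through a
   missing endpoint of [D]. *)
Definition weak_cvg D (F : set_system R) nu xi : Prop :=
  forall f, bounded_continuous_on D f ->
    pairing D f (nu s) @[s --> F] --> pairing D f xi.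

Definition weak_cadlag D nu : Prop :=
  (forall t, 0 <= t -> weak_cvg D t^'+ nu (nu t)) /\
  (forall t, 0 < t ->
    exists2 xi : submeasure, supported_on D xi & weak_cvg D t^'- nu xi).

End measures.

Section fluid.
Context {R : realType}.
Notation mu := (@lebesgue_measure R).
Notation submeasure := (subprobability (measurableTypeR R) R).
Implicit Types (D : set R) (h E X : R -> R) (nu : R -> submeasure).

(* One-sided at the endpoints of an interval [A]. *)
Definition derivative_within (A : set R) (f : R -> R) (x l : R) : Prop :=
  (f y - f x) / (y - x) @[y --> within A x^'] --> l.

(* [phi] is continuously differentiable with compact support on
   [D] * [0, oo), with first-order partial derivatives [phix], [phis]. *)
Record test_function D (phi phix phis : R -> R -> R) : Prop := {
  test_dx : forall x s, D x -> 0 <= s ->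
    derivative_within D (phi ^~ s) x (phix x s) ;
  test_ds : forall x s, D x -> 0 <= s ->
    derivative_within half_line (phi x) s (phis x s) ;
  test_dx_cont :
    {within D `*` half_line, continuous (fun p : R * R => phix p.1 p.2)} ;
  test_ds_cont :
    {within D `*` half_line, continuous (fun p : R * R => phis p.1 p.2)} ;
  test_support : exists C : set (R * R),
    [/\ compact C, C `<=` D `*` half_line &
        forall x s, D x -> 0 <= s -> phi x s != 0 -> C (x, s)] }.

Definition departures D h nu (t : R) : \bar R :=
  (\int[mu]_(s in `[0%R, t]) epairing D h (nu s))%E.

Definition entries D h (nu0 : submeasure) nu (t : R) : R :=
  pairing D (cst 1) (nu t) - pairing D (cst 1) nu0 +
  fine (departures D h nu t).

Definition initial_data D E (X0 : R) (nu0 : submeasure) : Prop :=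
  [/\ increasing_cadlag E, 0 <= X0, supported_on D nu0 &
      1 - pairing D (cst 1) nu0 = Num.max (1 - X0) 0].

Record fluid_solution D h E (X0 : R) (nu0 : submeasure) X nu : Prop := {
  fluid_X_ge0 : forall t, 0 <= t -> 0 <= X t ;
  fluid_nu_supp : forall t, 0 <= t -> supported_on D (nu t) ;
  fluid_X_cadlag : cadlag X ;
  fluid_nu_cadlag : weak_cadlag D nu ;
  fluid_departures_fin : forall t, 0 <= t -> (departures D h nu t < +oo)%E ;
  fluid_age : forall t, 0 <= t ->
    forall phi phix phis, test_function D phi phix phis ->
    exists2 I : R, is_RS_integral (phi 0) (entries D h nu0 nu) 0 t I &
      pairing D (phi ^~ t) (nu t) =
        pairing D (phi ^~ 0) nu0
        + (\int[mu]_(s in `[0, t]) pairing D (phis ^~ s) (nu s))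
        + (\int[mu]_(s in `[0, t]) pairing D (phix ^~ s) (nu s))
        - (\int[mu]_(s in `[0, t]) pairing D (fun x => h x * phi x s) (nu s))
        + I ;
  fluid_X : forall t, 0 <= t -> X t = X0 + E t - fine (departures D h nu t) ;
  fluid_idle : forall t, 0 <= t ->
    1 - pairing D (cst 1) (nu t) = Num.max (1 - X t) 0 }.

End fluid.

(* Main.v *)
Require Import Defs.
From HB Require Import structures.
From mathcomp Require Import all_boot all_order all_algebra.
From mathcomp Require Import all_classical all_reals all_analysis.
From mathcomp Require Import measurable_realfun.
From mathcomp Require Import ring lra.
Import Order.TTheory GRing.Theory Num.Theory.
Import numFieldNormedType.Exports.
Local Open Scope classical_set_scope.
Local Open Scope ring_scope.

(** The age equation is linear transport: mass moves along the characteristics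
    on which age minus time is constant, is killed at rate [h], and is injected
    at age 0 by [dK].  Since [(1 - G)^-1] solves [u' = h u] on the service
    interval, the test function [F (x + t - s) * chi s / (1 - G x)] satisfies
    [phi_s + phi_x = h phi] as long as [chi = 1].  Choosing [chi] to be 1 on
    [[0, t]] makes the three time integrals cancel and leaves boundary values
    only ([transport_identity]), for every [C^1] profile [F] that vanishes near
    the right end of the service interval.  The profile [f * (1 - G)] of the
    representation is neither smooth nor of compact support, but it is the
    limit of its averages over short windows to its right, which are; dominated
    convergence for the measures and uniform convergence for the
    Riemann-Stieltjes integral give [age_representation].

    Uniqueness.  The mass balance reads
    [K = min (X0 + E - Dep, 1) - min (X0, 1) + Dep], with [Dep] the cumulative
    departures, so [K] is non-decreasing ([entries_mono]) and a 1-Lipschitz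
    function of [Dep] ([entries_diff_le_departures]).  Conversely the
    representation with [f = 1] expresses [Dep] through the data and the
    convolution of [dK] with [G]; after summation by parts, two solutions whose
    entries agree up to time [a] and differ by at most [m] up to time [t] have
    departures that differ by at most [m * G (t - a)]
    ([departures_diff_le]).  As [G 0 = 0], this is a contraction on intervals
    of a fixed short length, and the entries agree on one after the other
    ([entries_unique]).  The representation then gives the same integrals of
    all bounded continuous functions, hence the same measures.

    Entry rate.  The increments of [K] are at most those of [E + Dep], so [K]
    is absolutely continuous along with [E].  Monotone absolutely continuous
    functions are differentiable almost everywhere, because their Stieltjes
    measures have densities ([absolutely_continuous_ae_derivable]).  Where
    [X < 1], respectively [X > 1], the mass balance makes [K] equal to [E],
    respectively [Dep], up to a constant near that time.  Where [X = 1], the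
    function [min (X, 1)] is at a maximum and [X - min (X, 1)] at a minimum,
    so both derivatives vanish: [K' = Dep' = E'], and the minimum of the two
    rates is attained by both ([entry_rate]).

    Absolute continuity of the age distribution.  The representation, applied
    to continuous functions that increase to the indicator of an open set of
    small Lebesgue measure, bounds the mass of that set by the initial mass of
    a translate plus the variation of [K] over a reflection of it; both are
    small by absolute continuity ([age_small_on_open]). *)

Set Implicit Arguments.
Unset Strict Implicit.
Unset Printing Implicit Defensive.

(** * Riemann-Stieltjes sums against a monotone integrator *)

Section riemann_stieltjes.
Context {R : realType}.
Implicit Types (f k w : R -> R) (a b d : R) (s : seq R).

Definition monotone_on a b k : Prop :=
  forall x y, a <= x -> x <= y -> y <= b -> k x <= k y.

Lemma partition_point_lt a b s i : itv_partition a b s -> (i < size s)%N ->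
  nth b (a :: s) i < nth b s i.
Proof. by case=> /(pathP b) p _ /p. Qed.

Lemma partition_point_last a b s : itv_partition a b s -> nth b (a :: s) (size s) = b.
Proof. by case=> _ /eqP; rewrite (last_nth b). Qed.

Lemma partition_point_mono a b s i j : itv_partition a b s ->
  (i <= j)%N -> (j <= size s)%N -> nth b (a :: s) i <= nth b (a :: s) j.
Proof.
move=> ps; elim: j => [|j IH]; first by rewrite leqn0 => /eqP->.
rewrite leq_eqVlt => /orP[/eqP->//|ij] js.
apply: (le_trans (IH ij (ltnW js))).
exact: ltW (partition_point_lt ps js).
Qed.

Lemma partition_point_ge a b s i : itv_partition a b s -> (i <= size s)%N ->
  a <= nth b (a :: s) i.
Proof. by move=> ps; exact: (@partition_point_mono a b s 0 i). Qed.

Lemma partition_point_le a b s i : itv_partition a b s -> (i <= size s)%N ->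
  nth b (a :: s) i <= b.
Proof.
move=> ps si; rewrite -[X in _ <= X](partition_point_last ps).
exact: partition_point_mono.
Qed.

Lemma RS_telescope a b s k : itv_partition a b s ->
  \sum_(i < size s) (k (nth b s i) - k (nth b (a :: s) i)) = k b - k a.
Proof.
move=> ps; rewrite -(big_mkord xpredT (fun i => k (nth b s i) - k (nth b (a :: s) i))).
rewrite (telescope_sumr_eq (fun i => k (nth b (a :: s) i)))//.
by rewrite partition_point_last.
Qed.

Lemma fine_partition a b d : a <= b -> 0 < d -> exists2 s, itv_partition a b s &
  forall i, (i < size s)%N -> nth b s i - nth b (a :: s) i < d.
Proof.
move=> ab d0.
pose e := d / 2; have e0 : 0 < e by rewrite divr_gt0.
have ed : e < d by rewrite /e; lra.
pose n := Num.Def.truncn ((b - a) / e); have : b - a <= n.+1%:R * e.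
  rewrite -ler_pdivrMr//; apply/ltW/truncnS_gt.
move: (n.+1) => N; clearbody e; clear n; elim: N a ab => [|n IH] a ab.
  rewrite mul0r => ba; have -> : a = b by lra.
  by exists [::] => //; split.
move=> ba; have [bae|bae] := leP (b - a) e.
  have [->|/eqP nab] := eqVneq a b; first by exists [::] => //; split.
  exists [:: b]; first by split => //=; rewrite andbT; lra.
  by case=> // _ /=; lra.
have [||s [ps ls] fs] := IH (a + e); first lra.
  by rewrite -natr1 mulrDl mul1r in ba; lra.
exists (a + e :: s); first by split => //=; rewrite ps andbT; lra.
by case=> [_|i /fs] //=; lra.
Qed.

Lemma RS_sum_bound f k a b s c B : itv_partition a b s ->
  monotone_on a b k -> (forall x, a <= x <= b -> `|f x| <= B) ->
  (forall i, (i < size s)%N -> nth b (a :: s) i <= c i <= nth b s i) ->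
  `|RS_sum f k a b s c| <= B * (k b - k a).
Proof.
move=> ps mk fB cs; rewrite -(RS_telescope k ps) mulr_sumr.
apply: le_trans (ler_norm_sum _ _ _) _; apply: ler_sum => i _.
have P := partition_point_ge ps (ltnW (ltn_ord i)).
have Q := partition_point_le ps (ltn_ord i).
have /andP[c1 c2] := cs _ (ltn_ord i).
have S := partition_point_lt ps (ltn_ord i).
have K : 0 <= k (nth b s i) - k (nth b (a :: s) i).
  by rewrite subr_ge0; apply: mk => //; exact: ltW.
rewrite normrM (ger0_norm K) ler_wpM2r//; apply: fB.
by rewrite (le_trans P c1) (le_trans c2).
Qed.

Lemma eq_RS_integral f1 f2 k1 k2 a b I :
  (forall x, a <= x <= b -> f1 x = f2 x) ->
  (forall x, a <= x <= b -> k1 x = k2 x) ->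
  is_RS_integral f1 k1 a b I -> is_RS_integral f2 k2 a b I.
Proof.
move=> ff kk hI e e0; have [d d0 H] := hI e e0; exists d => // s c ps cs.
rewrite (_ : RS_sum f2 k2 a b s c = RS_sum f1 k1 a b s c); first exact: H.
apply: eq_bigr => i _; have [c1 c2 _] := cs _ (ltn_ord i).
have P0 := partition_point_ge ps (ltnW (ltn_ord i)).
have Q1 := partition_point_le ps (ltn_ord i).
have PQ := partition_point_lt ps (ltn_ord i).
rewrite ff ?kk//.
- by rewrite P0 (le_trans (ltW PQ)).
- by rewrite (le_trans P0 (ltW PQ)).
- by rewrite (le_trans P0 c1) (le_trans c2).
Qed.

Lemma RS_integral_unique f k a b I J : a <= b ->
  is_RS_integral f k a b I -> is_RS_integral f k a b J -> I = J.
Proof.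
move=> ab hI hJ; apply/eqP; rewrite -subr_eq0 -normr_le0.
apply/ler_addgt0Pl => e e0; rewrite addr0.
have [d1 d10 h1] := hI _ (divr_gt0 e0 (@ltr0Sn R 1)).
have [d2 d20 h2] := hJ _ (divr_gt0 e0 (@ltr0Sn R 1)).
have d0 : 0 < Num.min d1 d2 by rewrite lt_min d10.
have [s ps fs] := fine_partition ab d0.
have H1 := h1 s (nth b (a :: s)) ps; have H2 := h2 s (nth b (a :: s)) ps.
have {}H1 : `|RS_sum f k a b s (nth b (a :: s)) - I| < e / 2.
  apply: H1 => i si; have := fs _ si; rewrite lt_min => /andP[? _].
  by split => //; exact: ltW (partition_point_lt ps si).
have {}H2 : `|RS_sum f k a b s (nth b (a :: s)) - J| < e / 2.
  apply: H2 => i si; have := fs _ si; rewrite lt_min => /andP[_ ?].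
  by split => //; exact: ltW (partition_point_lt ps si).
move: H1 H2; rewrite !ltr_distl => /andP[? ?] /andP[? ?].
by rewrite ler_norml; apply/andP; split; lra.
Qed.

(** The sums against a monotone integrator are Lipschitz in the integrand,
    with the same constant for all partitions; hence one partition size serves
    a function and its uniform approximations alike, and integrability passes
    to the limit together with the value. *)
Lemma RS_integral_uniform_limit (F_ : nat -> R -> R) f k a b (I_ : nat -> R) I :
  monotone_on a b k -> a <= b ->
  (forall e, 0 < e -> \forall n \near \oo, forall x, a <= x <= b ->
     `|F_ n x - f x| <= e) ->
  (forall n, is_RS_integral (F_ n) k a b (I_ n)) ->
  I_ n @[n --> \oo] --> I -> is_RS_integral f k a b I.
Proof.
move=> mk ab uF hI cI e e0.
have kab : 0 <= k b - k a by rewrite subr_ge0; exact: mk.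
have e3 : 0 < e / 3 by rewrite divr_gt0.
pose u := e / 3 / (k b - k a + 1).
have u0 : 0 < u by rewrite divr_gt0// ltr_wpDl.
have /cvgrPdist_lt/(_ _ e3) cI' := cI.
have [n [Fn In]] := filter_ex (filterI (uF _ u0) cI').
have [d d0 hd] := hI n _ e3.
exists d => // s c ps hs; have H := hd s c ps hs.
have B : `|RS_sum (fun x => F_ n x - f x) k a b s c| <= u * (k b - k a).
  apply: RS_sum_bound => // i /hs[? ? _]; exact/andP.
have E : RS_sum (fun x => F_ n x - f x) k a b s c
   = RS_sum (F_ n) k a b s c - RS_sum f k a b s c.
  by rewrite /RS_sum -sumrB; apply: eq_bigr => i _; rewrite mulrBl.
rewrite E in B.
have ub : u * (k b - k a) <= e / 3.
  rewrite /u -mulrA ler_piMr// ?ltW//.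
  by rewrite mulrC ltr_pdivrMr ?ltr_wpDl// mul1r ltrDl.
move: In H B; rewrite !ltr_distl ler_norml => /andP[? ?] /andP[? ?] /andP[? ?].
by apply/andP; split; lra.
Qed.

(** The difference [k1 - k2] need not be monotone, so its increments are not
    controlled by its size. Abel summation moves them onto the monotone weight
    [w], and partition points up to [a] contribute nothing. *)
Lemma RS_by_parts_bound w k1 k2 (t a m I1 I2 : R) : 0 <= a -> a <= t ->
  monotone_on 0 t w -> 0 <= m ->
  (forall x, 0 <= x <= t -> `|k1 x - k2 x| <= m) ->
  (forall x, 0 <= x <= a -> k1 x = k2 x) ->
  is_RS_integral w k1 0 t I1 -> is_RS_integral w k2 0 t I2 ->
  `|w t * (k1 t - k2 t) - (I1 - I2)| <= m * (w t - w a).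
Proof.
move=> a0 at_ mw m0 km ka h1 h2; apply/ler_addgt0Pl => e e0.
have t0 := le_trans a0 at_.
have [d1 d10 {}h1] := h1 _ (divr_gt0 e0 (@ltr0Sn R 1)).
have [d2 d20 {}h2] := h2 _ (divr_gt0 e0 (@ltr0Sn R 1)).
have d0 : 0 < Num.min d1 d2 by rewrite lt_min d10.
have [s ps fs] := fine_partition t0 d0.
have H1 : `|RS_sum w k1 0 t s (nth t s) - I1| < e / 2.
  apply: h1 => // i si; have := fs _ si; rewrite lt_min => /andP[? _].
  by split => //; exact: ltW (partition_point_lt ps si).
have H2 : `|RS_sum w k2 0 t s (nth t s) - I2| < e / 2.
  apply: h2 => // i si; have := fs _ si; rewrite lt_min => /andP[_ ?].
  by split => //; exact: ltW (partition_point_lt ps si).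
pose k x := k1 x - k2 x.
pose P := nth t (0 :: s).
(* Constant up to [a], so that the bounds below telescope to [w t - w a]
   instead of [w t - w 0]. *)
pose H x := if x <= a then w a else w x.
have E : w t * k t - (RS_sum w k1 0 t s (nth t s) - RS_sum w k2 0 t s (nth t s))
   = \sum_(i < size s) k (P i) * (w (P i.+1) - w (P i)).
  transitivity (\sum_(i < size s) (w (P i.+1) * k (P i.+1) - w (P i) * k (P i))
     - (RS_sum w k1 0 t s (nth t s) - RS_sum w k2 0 t s (nth t s))).
    congr (_ - _).
    rewrite (RS_telescope (fun x => w x * k x) ps).
    by rewrite [k 0](_ : _ = 0) ?mulr0 ?subr0// /k ka ?subrr// lexx.
  rewrite /RS_sum -!sumrB; apply: eq_bigr => i _.
  by rewrite /k /P /=; ring.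
have B : `|\sum_(i < size s) k (P i) * (w (P i.+1) - w (P i))| <= m * (w t - w a).
  have -> : w t - w a = \sum_(i < size s) (H (P i.+1) - H (P i)).
    rewrite (RS_telescope H ps) /H a0; case: ifPn => // ta.
    by have -> : t = a by apply/le_anti; rewrite ta.
  rewrite mulr_sumr; apply: le_trans (ler_norm_sum _ _ _) _.
  apply: ler_sum => i _.
  have P0 : 0 <= P i := partition_point_ge ps (ltnW (ltn_ord i)).
  have Pt : P i.+1 <= t := partition_point_le ps (ltn_ord i).
  have PP : P i <= P i.+1 := ltW (partition_point_lt ps (ltn_ord i)).
  have W : w (P i) <= w (P i.+1) by exact: mw.
  rewrite normrM [`|w _ - _|]ger0_norm ?subr_ge0// /H.
  have [Pa|Pa] := leP (P i) a.
    have -> : k (P i) = 0 by rewrite /k ka ?subrr// P0.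
    rewrite normr0 mul0r mulr_ge0// subr_ge0; case: ifPn => //; rewrite -ltNge => aP.
    by apply: mw => //; exact: ltW.
  rewrite [P i.+1 <= a]leNgt (lt_le_trans Pa PP)/= ler_wpM2r ?subr_ge0//.
  by rewrite km// P0 (le_trans PP).
rewrite -E in B; move: B H1 H2; rewrite !ltr_distl !ler_norml -/(k t).
move=> /andP[? ?] /andP[? ?] /andP[? ?]; apply/andP; split; lra.
Qed.

End riemann_stieltjes.

(** A partition interval contributes only if its tag lies in the support of
    [f]; such an interval is contained in [W] once the mesh is at most [r],
    and distinct ones are disjoint, so that the variation of [k] over them is
    small. *)
Lemma RS_integral_small (R : realType) (f k : R -> R) (t I e r : R)
    (W : set (measurableTypeR R)) :
  0 <= t -> 0 < r -> monotone_on 0 t k ->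
  (forall s, 0 <= s <= t -> 0 <= f s <= 1) ->
  (forall s z, 0 <= s <= t -> f s != 0 -> `|s - z| <= r -> W z) ->
  (forall n (a b : 'I_n -> R), (forall i, [/\ 0 <= a i, a i <= b i & b i <= t]) ->
    trivIset setT (fun i => [set` `]a i, b i[]) ->
    (forall i, [set` `]a i, b i[] `<=` W) ->
    \sum_(i < n) `|k (b i) - k (a i)| < e) ->
  is_RS_integral f k 0 t I -> I <= e.
Proof.
move=> t0 r0 mk f01 fW small hI; apply/ler_addgt0Pr => eta eta0.
have [d d0 hd] := hI _ eta0.
have m0 : 0 < Num.min d r by rewrite lt_min d0.
have [s ps fs] := fine_partition t0 m0.
pose P := nth t (0 :: s).
have H : `|RS_sum f k 0 t s P - I| < eta.
  apply: hd => // i si; have := fs _ si; rewrite lt_min => /andP[? _].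
  by split => //; exact: ltW (partition_point_lt ps si).
(* Intervals that contribute nothing are shrunk to a point, which keeps the
   family indexed by the whole partition. *)
pose b (i : 'I_(size s)) := if f (P i) != 0 then P i.+1 else P i.
have P0t (i : 'I_(size s)) : [/\ 0 <= P i, P i < P i.+1 & P i.+1 <= t].
  have i0 : 0 <= P i := partition_point_ge ps (ltnW (ltn_ord i)).
  have it : P i.+1 <= t := partition_point_le ps (ltn_ord i).
  by have ii : P i < P i.+1 := partition_point_lt ps (ltn_ord i).
have bP i : b i <= P i.+1.
  by rewrite /b; case: ifP => // _; have [_ /ltW] := P0t i.
have Pm i j : (i <= j)%N -> (j <= size s)%N -> P i <= P j by exact: partition_point_mono.
have S : \sum_(i < size s) `|k (b i) - k (P i)| < e.
  apply: small.
  - move=> i; have [p0 pp pt] := P0t i; split => //; rewrite /b; case: ifP => // _.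
    + exact: ltW.
    + exact: le_trans (ltW pp) pt.
  - move=> i j _ _ [x [/=]]; rewrite !in_itv/= => /andP[ix xi] /andP[jx xj].
    apply/val_inj/eqP; rewrite /= eqn_leq; apply/andP; split; rewrite leqNgt; apply/negP => ij.
      have := Pm _ _ ij (ltnW (ltn_ord i)); have := bP j; lra.
    have := Pm _ _ ij (ltnW (ltn_ord j)); have := bP i; lra.
  - move=> i z /=; rewrite in_itv/= /b; have [p0 pp pt] := P0t i.
    case: ifPn => [fi /andP[Pz zP]|_ /andP[Pz zP]]; last first.
      by have := lt_trans Pz zP; rewrite ltxx.
    apply: (fW (P i)) => //; first by rewrite p0 (le_trans (ltW pp)).
    have := fs i (ltn_ord i); rewrite lt_min => /andP[_ mesh].
    rewrite distrC ger0_norm; first by rewrite /P /= in zP mesh *; lra.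
    by rewrite subr_ge0 ltW.
have : RS_sum f k 0 t s P <= \sum_(i < size s) `|k (b i) - k (P i)|.
  apply: ler_sum => i _; have [p0 pp pt] := P0t i.
  have K0 : 0 <= k (P i.+1) - k (P i) by rewrite subr_ge0; apply: mk => //; exact: ltW.
  have [f0 f1] : 0 <= f (P i) /\ f (P i) <= 1.
    by apply/andP; apply: f01; rewrite p0 (le_trans (ltW pp)).
  rewrite /b; case: (eqVneq (f (P i)) 0) => [->|_] /=.
    by rewrite mul0r.
  by rewrite (ger0_norm K0) ler_piMl.
by move: H; rewrite ltr_distl => /andP[? ?] ?; lra.
Qed.

(** * Derivatives and integrals on intervals *)

Section derivative_within_rules.
Context {R : realType}.
Implicit Types (A : set R) (f g : R -> R) (x l m : R).

Lemma near_within_dnbhs A x : \forall y \near within A x^', A y /\ y != x.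
Proof. by exists 1 => //= y _ yx Ay. Qed.

Lemma derivative_within_cvg A f x l : derivative_within A f x l ->
  f y @[y --> within A x^'] --> f x.
Proof.
move=> df; have : f x + (y - x) * ((f y - f x) / (y - x)) @[y --> within A x^']
    --> f x + (x - x) * l.
  apply: cvgD; first exact: cvg_cst.
  apply: cvgM => //; apply: cvgB; last exact: cvg_cst.
  do 2 apply: cvg_within_filter. exact: cvg_id.
rewrite subrr mul0r addr0; apply: cvg_trans; apply: near_eq_cvg.
near=> y; have [_ yx] : A y /\ y != x by near: y; exact: near_within_dnbhs.
by rewrite mulrCA divff ?subr_eq0// mulr1 addrC subrK.
Unshelve. all: by end_near. Qed.

Lemma derivative_withinM A f g x l m :
  derivative_within A f x l -> derivative_within A g x m ->
  derivative_within A (fun y => f y * g y) x (l * g x + f x * m).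
Proof.
move=> df dg; have gc := derivative_within_cvg dg.
have : (f y - f x) / (y - x) * g y + f x * ((g y - g x) / (y - x))
    @[y --> within A x^'] --> l * g x + f x * m.
  by apply: cvgD; apply: cvgM => //; exact: cvg_cst.
apply: cvg_trans; apply: near_eq_cvg; near=> y.
by rewrite mulrAC mulrA -mulrDl; congr (_ * _); ring.
Unshelve. all: by end_near. Qed.

Lemma derivative_withinV A f x l : f x != 0 ->
  derivative_within A f x l ->
  derivative_within A (fun y => (f y)^-1) x (- l / f x ^+ 2).
Proof.
move=> fx0 df; have fc := derivative_within_cvg df.
have : - ((f y - f x) / (y - x)) * (f y)^-1 * (f x)^-1
    @[y --> within A x^'] --> - l * (f x)^-1 * (f x)^-1.
  apply: cvgM; last exact: cvg_cst.
  by apply: cvgM; [exact: cvgN|exact: cvgV].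
rewrite -mulrA -invfM -expr2; apply: cvg_trans; apply: near_eq_cvg; near=> y.
have fy0 : f y != 0 by near: y; exact: (cvgr_neq0 _ fc).
have [_ yx] : A y /\ y != x by near: y; exact: near_within_dnbhs.
rewrite -subr_eq0 in yx.
by field; rewrite fx0 fy0 yx.
Unshelve. all: by end_near. Qed.

Lemma is_derive_derivative_within A f x l :
  is_derive x 1 f l -> derivative_within A f x l.
Proof.
move=> df; rewrite /derivative_within.
apply: cvg_within_filter.
have [df1 df2] := df.
have : h^-1 *: ((f \o shift x) (h *: 1) - f x) @[h --> 0^'] --> l.
  by rewrite -df2; exact: df1.
move=> H.
have : (fun y => (y - x)^-1 *: ((f \o shift x) ((y - x) *: 1) - f x)) @ x^' --> l.
  apply: (cvg_comp (fun y => y - x) _ _ H).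
  move=> P [e /= e0 eP]; exists e => //= y /= xy yx.
  apply: eP; last by rewrite subr_eq0.
  by rewrite /ball_/= in xy *; rewrite sub0r opprB.
apply: cvg_trans; apply: near_eq_cvg; near=> y.
by rewrite /= /GRing.scale/= mulr1 subrK mulrC.
Unshelve. all: by end_near. Qed.

Lemma derivative_within_cst A (r x : R) : derivative_within A (fun=> r) x 0.
Proof.
by apply: cvg_near_cst; near=> y; rewrite subrr mul0r.
Unshelve. all: by end_near. Qed.

Lemma Rintegral_close (u : R -> R) (x y l e : R) : x <= y ->
  lebesgue_measure.-integrable `[x, y] (EFin \o u) ->
  (forall z, x <= z <= y -> `|u z - l| <= e) ->
  `|\int[lebesgue_measure]_(z in `[x, y]) u z - l * (y - x)| <= e * (y - x).
Proof.
move=> xy iu ul.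
have cst_int (r : R) : \int[lebesgue_measure]_(z in `[x, y]) r = r * (y - x).
  rewrite Rintegral_cst//= lebesgue_measure_itv/= lte_fin; case: ltP => //= yx.
  by have -> : y = x; [exact/le_anti/andP|rewrite subrr].
have icst (r : R) : lebesgue_measure.-integrable `[x, y] (EFin \o (cst r : R -> R)).
  apply: continuous_compact_integrable; first exact: segment_compact.
  by apply: continuous_subspaceT => z; exact: cvg_cst.
have iul : lebesgue_measure.-integrable `[x, y] (EFin \o (fun z => u z - l)).
  have mI : measurable (`[x, y] : set (measurableTypeR R)) by exact: measurable_itv.
  have H := integrableB mI iu (icst l).
  exact: H.
rewrite -!cst_int -RintegralB//; last exact: icst.
apply: le_trans (le_normr_Rintegral _ _) _ => //.
apply: le_Rintegral => //.
- exact: (integrable_abse iul).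
- exact: icst.
Qed.

(** The fundamental theorem of calculus relative to an interval [A], one-sided
    at its end points: difference quotients are means of [u], and near [x] the
    values of [u] on [A] are close to [u x]. *)
Lemma primitive_derivative_within A f (u : R -> R) x : is_interval A -> A x ->
  (forall a b, A a -> A b -> a <= b ->
     lebesgue_measure.-integrable `[a, b] (EFin \o u) /\
     f b - f a = \int[lebesgue_measure]_(z in `[a, b]) u z) ->
  u y @[y --> within A (nbhs x)] --> u x ->
  derivative_within A f x (u x).
Proof.
move=> iA Ax fu cu; apply/cvgrPdist_le => e e0.
have /cvgrPdist_le/(_ _ e0) := cu.
rewrite near_withinE => -[d /= d0 hd].
have div_close I w : 0 < w -> `|I - u x * w| <= e * w -> `|u x - I / w| <= e.
  move=> w0 H; rewrite distrC -[u x](mulfK (lt0r_neq0 w0)) -mulrBl normrM.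
  by rewrite normfV (gtr0_norm w0) ler_pdivrMr.
have key y : A y -> `|x - y| < d -> y != x ->
    `|u x - (f y - f x) / (y - x)| <= e.
  move=> Ay xyd yx; have [xy|yx'] := leP x y.
    have [iu ->] := fu _ _ Ax Ay xy.
    have yx0 : 0 < y - x by rewrite subr_gt0 lt_neqAle xy eq_sym yx.
    apply: div_close => //; apply: Rintegral_close => // z /andP[xz zy].
    rewrite distrC; apply: hd; last by apply: (iA x y) => //; rewrite xz.
    rewrite /ball_/=; apply: le_lt_trans xyd.
    by rewrite ler0_norm ?subr_le0// ler0_norm ?subr_le0//; lra.
  have [iu E] := fu _ _ Ay Ax (ltW yx').
  have yx0 : 0 < x - y by rewrite subr_gt0.
  have -> : (f y - f x) / (y - x) = (f x - f y) / (x - y).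
    by rewrite -[f y - _]opprB -[y - x]opprB invrN mulrNN.
  rewrite E; apply: div_close => //.
  apply: Rintegral_close => // [|z /andP[yz zx]]; first exact: ltW.
  rewrite distrC; apply: hd; last by apply: (iA y x) => //; rewrite yz.
  rewrite /ball_/=; apply: le_lt_trans xyd.
  by rewrite ger0_norm ?subr_ge0// ger0_norm ?subr_ge0//; lra.
rewrite near_withinE; exists d => //= y /= xyd yx Ay; exact: key.
Qed.

End derivative_within_rules.

Section derivatives.
Context {R : realType}.

Lemma is_derive_quadratic (f : R -> R) (x l C : R) :
  (forall e, `|f (x + e) - f x - l * e| <= C * e ^+ 2) -> is_derive x 1 f l.
Proof.
move=> H; have C0 : 0 <= C.
  by have := le_trans (normr_ge0 _) (H 1); rewrite expr1n mulr1.
have : h^-1 *: ((f \o shift x) (h *: 1) - f x) @[h --> 0^'] --> l.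
  apply/cvgrPdist_le => e e0.
  near=> h0.
  have h00 : h0 != 0 by near: h0; exact: nbhs_dnbhs_neq.
  have hC : (C + 1) * `|h0| <= e.
    rewrite -ler_pdivlMl ?ltr_wpDl//.
    near: h0; apply: cvg_within.
    have e1 : 0 < (C + 1)^-1 * e by rewrite mulr_gt0// invr_gt0 ltr_wpDl.
    by exists ((C + 1)^-1 * e) => //= y /=; rewrite sub0r normrN => /ltW.
  rewrite /= /GRing.scale/= mulr1 [h0 + x]addrC; have H' := H h0.
  have -> : l - h0^-1 * (f (x + h0) - f x) = - h0^-1 * (f (x + h0) - f x - l * h0).
    by field.
  rewrite normrM normrN normfV; apply: (@le_trans _ _ (`|h0|^-1 * (C * h0 ^+ 2))).
    by rewrite ler_wpM2l.
  rewrite -[h0 ^+ 2]ger0_norm ?sqr_ge0// normrX mulrCA expr2 mulKf ?normr_eq0//.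
  by apply: le_trans hC; rewrite ler_wpM2r// lerDl.
move=> dl; apply: DeriveDef; first by apply/cvg_ex; exists l.
exact: cvg_lim dl.
Unshelve. all: by end_near. Qed.

End derivatives.

Lemma derivable_is_derive1 (R : realType) (f : R -> R) (t : R) :
  derivable f t 1 -> is_derive t 1 f (derive1 f t).
Proof. by move=> df; apply: DeriveDef => //; rewrite derive1E. Qed.

(** Fermat's rule, with differentiability required at the one point [t] only:
    the functions it is applied to are differentiable almost everywhere, but
    possibly not on a neighbourhood of [t]. *)
Lemma is_derive_local_max (R : realType) (f : R -> R) (t l : R) :
  is_derive t 1 f l -> (\forall y \near t, f y <= f t) -> l = 0.
Proof.
move=> /(@is_derive_derivative_within _ setT) df fmax.
apply/eqP; rewrite eq_le !leNgt; apply/andP; split; apply/negP => l0.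
- suff : \forall y \near t^'+, False by move/filter_ex => [].
  have H1 : \forall y \near t^'+, y != t -> setT y -> 0 < (f y - f t) / (y - t).
    by apply: cvg_within; exact: (cvgr_gt _ df _ l0).
  have H2 : \forall y \near t^'+, f y <= f t by apply: cvg_within; exact: fmax.
  near=> y; have ty : t < y by near: y; exact: nbhs_right_gt.
  have fy : f y <= f t by near: y.
  have : y != t -> setT y -> 0 < (f y - f t) / (y - t) by near: y.
  rewrite gt_eqF// => /(_ isT I).
  by rewrite pmulr_lgt0 ?invr_gt0 ?subr_gt0// ltNge fy.
- suff : \forall y \near t^'-, False by move/filter_ex => [].
  have H1 : \forall y \near t^'-, y != t -> setT y -> (f y - f t) / (y - t) < 0.
    by apply: cvg_within; exact: (cvgr_lt _ df _ l0).
  have H2 : \forall y \near t^'-, f y <= f t by apply: cvg_within; exact: fmax.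
  near=> y; have ty : y < t by near: y; exact: nbhs_left_lt.
  have fy : f y <= f t by near: y.
  have : y != t -> setT y -> (f y - f t) / (y - t) < 0 by near: y.
  rewrite lt_eqF// => /(_ isT I).
  by rewrite -mulrNN -invrN !opprB pmulr_llt0 ?invr_gt0 ?subr_gt0// subr_lt0 ltNge fy.
Unshelve. all: by end_near. Qed.

Section cutoff.
Context {R : realType}.

Let p (u : R) : R := Num.max u 0.

Let p_continuous : continuous p.
Proof.
by move=> x; apply: continuous_max; [exact: cvg_id|exact: cvg_cst].
Qed.

Let is_derive_sqr_pos (u : R) : is_derive u 1 (fun v => p v ^+ 2) (2 * p u).
Proof.
apply: (@is_derive_quadratic _ _ _ _ 1) => e; rewrite /p mul1r ler_norml.
have [u0|u0] := leP u 0; have [v0|v0] := leP (u + e) 0; rewrite ?expr0n/=; apply/andP; split; nra.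
Qed.

(** The square of the positive part is [C^1]; so is [((1 - (v^+)^2)^+)^2],
    which is 1 for [v <= 0] and 0 for [v >= 1]. *)
Lemma smooth_cutoff (t d : R) : 0 < d -> exists chi chi' : R -> R,
  [/\ forall s : R, is_derive s 1 chi (chi' s), continuous chi',
      forall s, s <= t -> chi s = 1, forall s, s <= t -> chi' s = 0 &
      forall s, t + d <= s -> chi s = 0 /\ chi' s = 0].
Proof.
move=> d0; pose v s := (s - t) / d.
exists (fun s => p (1 - p (v s) ^+ 2) ^+ 2).
exists (fun s => 2 * p (1 - p (v s) ^+ 2) * (0 - 2 * p (v s) * d^-1)).
have vc : continuous v.
  move=> s; apply: cvgM; last exact: cvg_cst.
  by apply: cvgB; [exact: cvg_id|exact: cvg_cst].
have pvc : continuous (fun s => p (v s)).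
  by move=> s; apply: continuous_comp; [exact: vc|exact: p_continuous].
split.
- move=> s.
  have dv : is_derive s 1 v (d^-1).
    apply: (@is_derive_quadratic _ _ _ _ 0) => e; rewrite mul0r.
    rewrite (_ : _ - _ = 0) ?normr0// /v; field; exact: lt0r_neq0.
  have dpv : is_derive s 1 (fun s : R => p (v s) ^+ 2) (2 * p (v s) * d^-1).
    exact: (is_derive1_comp (f := fun u => p u ^+ 2) (g := v)).
  have d1 : is_derive s 1 (fun s : R => 1 - p (v s) ^+ 2) (0 - 2 * p (v s) * d^-1).
    have d1 := is_derive_cst (1 : R) s (1 : R).
    by have := is_deriveB d1 dpv.
  exact: (is_derive1_comp (f := fun u => p u ^+ 2)
    (g := fun s => 1 - p (v s) ^+ 2)).
- move=> s; apply: cvgM.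
    apply: cvgM; first exact: cvg_cst.
    apply: (@continuous_comp _ _ _ (fun s => 1 - p (v s) ^+ 2) p); last exact: p_continuous.
    apply: cvgB; first exact: cvg_cst.
    by apply: cvgM; exact: pvc.
  apply: cvgB; first exact: cvg_cst.
  apply: cvgM; last exact: cvg_cst.
  by apply: cvgM; [exact: cvg_cst|exact: pvc].
- move=> s st; have -> : p (v s) = 0 by rewrite /p max_r// /v pmulr_lle0 ?invr_gt0// subr_le0.
  by rewrite expr0n/= subr0 /p max_l// expr1n.
- move=> s st; have -> : p (v s) = 0 by rewrite /p max_r// /v pmulr_lle0 ?invr_gt0// subr_le0.
  by rewrite mulr0 mul0r subr0 mulr0.
- move=> s st; have v1 : 1 <= v s by rewrite /v ler_pdivlMr// mul1r lerBrDl.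
  have -> : p (v s) = v s by rewrite /p max_l// (le_trans _ v1).
  have v21 : 1 <= v s ^+ 2 by rewrite exprn_ege1.
  by rewrite /p max_r ?expr0n//= ?subr_le0// mulr0 mul0r.
Qed.

End cutoff.

Lemma continuous_integrable_itv (R : realType) (u : R -> R) (a b : R) : continuous u ->
  lebesgue_measure.-integrable `[a, b] (EFin \o u).
Proof.
move=> cu; apply: continuous_compact_integrable; first exact: segment_compact.
exact: continuous_subspaceT.
Qed.

(** * Smoothing by averages over a window to the right *)

Section smoothing.
Context {R : realType}.
Notation mu := (@lebesgue_measure R).
Variables (F w : R -> R).
Hypothesis cF : continuous F.
Hypothesis w_mono : forall x y, x <= y -> w y <= w x.
Hypothesis Fw : forall x, `|F x| <= w x.

Let N (n : nat) : R := n.+1%:R.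
Let N_gt0 n : 0 < N n. Proof. by rewrite /N. Qed.
Let Ni n : R := (N n)^-1.
Let Ni_gt0 n : 0 < Ni n. Proof. by rewrite invr_gt0. Qed.

(** The ramp from 1 to 0 on [[n, n + 1]] gives compact support when the
    service interval is unbounded. *)
Definition truncate n (y : R) : R := F y * Num.max (Num.min (n.+1%:R - y) 1) 0.

Lemma truncate_continuous n : continuous (truncate n).
Proof.
have ramp : continuous (fun y : R => Num.max (Num.min (n.+1%:R - y) 1) 0).
  move=> y; apply: (@continuous_max R R (fun y => Num.min (n.+1%:R - y) 1) (cst 0)).
    apply: (@continuous_min R R (fun y => n.+1%:R - y) (cst 1)); last exact: cvg_cst.
    by apply: cvgB; [exact: cvg_cst|exact: cvg_id].
  exact: cvg_cst.
by move=> y; apply: cvgM; [exact: cF|exact: ramp].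
Qed.

Lemma truncate_id n y : y <= n%:R -> truncate n y = F y.
Proof.
by move=> yn; rewrite /truncate min_r ?max_l ?mulr1// -natr1; lra.
Qed.

Lemma truncate_far n y : n.+1%:R <= y -> truncate n y = 0.
Proof.
move=> ny; rewrite /truncate max_r ?mulr0// ge_min; apply/orP; left; lra.
Qed.

Lemma truncate_le n y : `|truncate n y| <= `|F y|.
Proof.
rewrite normrM ler_piMr// ger0_norm; first by rewrite ge_max ler01 ge_min lexx orbT.
by rewrite le_max lexx orbT.
Qed.

(** The window lies strictly to the right of [x], so that the average inherits
    the non-increasing majorant [w], and vanishes already shortly before the
    point where [F] starts to vanish. *)
Definition smoothing n x : R :=
  N n * \int[mu]_(y in `[x + Ni n, x + 2 * Ni n]) truncate n y.

Definition smoothing' n x : R :=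
  N n * (truncate n (x + 2 * Ni n) - truncate n (x + Ni n)).

Lemma smoothing'_continuous n : continuous (smoothing' n).
Proof.
have c (r : R) : continuous (fun x => truncate n (x + r)).
  move=> x; apply: (@continuous_comp _ _ _ (fun x => x + r) (truncate n)).
    by apply: cvgD; [exact: cvg_id|exact: cvg_cst].
  exact: truncate_continuous.
by move=> x; apply: cvgM; [exact: cvg_cst|apply: cvgB; exact: c].
Qed.

Lemma is_derive_smoothing n (x : R) : is_derive x 1 (smoothing n) (smoothing' n x).
Proof.
pose a := x - 1.
pose Q y := \int[mu]_(z in `[a, y]) truncate n z.
have dQ y : a < y -> is_derive y 1 Q (truncate n y).
  move=> ay; have y1 : y < y + 1 by rewrite ltrDl.
  have [dq qE] := continuous_FTC1_closed y1
    (continuous_integrable_itv a (y + 1) (@truncate_continuous n)) ay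
    (@truncate_continuous n y).
  apply: DeriveDef; first exact: dq.
  by rewrite -derive1E; exact: qE.
have dQr r : 0 <= r -> is_derive x 1 (fun y => Q (y + r)) (truncate n (x + r)).
  move=> r0.
  have d1 : is_derive x 1 (fun y => y + r) 1.
    apply: (@is_derive_quadratic _ _ _ _ 0) => e; rewrite mul0r (_ : _ - _ = 0) ?normr0//; ring.
  have ax : a < x + r by rewrite /a; lra.
  have := @is_derive1_comp _ Q (fun y => y + r) x _ _ (dQ _ ax) d1.
  by rewrite mulr1.
have d2 := dQr (2 * Ni n) (mulr_ge0 (ler0n _ 2) (ltW (Ni_gt0 n))).
have d1 := dQr (Ni n) (ltW (Ni_gt0 n)).
have dB := is_deriveB d2 d1.
have dZ := is_deriveZ (N n) dB.
apply: near_eq_is_derive dZ.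
near=> y.
have ay : a <= y by apply/ltW; near: y; apply: lt_nbhsr; rewrite /a; lra.
have ? := Ni_gt0 n.
rewrite /= /GRing.scale/= /smoothing; congr (_ * _).
transitivity (Q (y + 2 * Ni n) - Q (y + Ni n)); first by [].
rewrite /Q Rintegral_itvB; first last.
- by rewrite bnd_simp; lra.
- by rewrite bnd_simp; lra.
- exact: continuous_integrable_itv (@truncate_continuous n).
rewrite Rintegral_itv_obnd_cbnd//.
apply: integrableS (continuous_integrable_itv (y + Ni n) (y + 2 * Ni n)
  (@truncate_continuous n)) => //.
exact: subset_itv_oc_cc.
Unshelve. all: by end_near. Qed.

Lemma smoothing_close n x l e : 
  (forall y, x + Ni n <= y <= x + 2 * Ni n -> `|truncate n y - l| <= e) ->
  `|smoothing n x - l| <= e.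
Proof.
move=> H; have Ni0 := Ni_gt0 n.
have xy : x + Ni n <= x + 2 * Ni n by lra.
have := Rintegral_close xy (continuous_integrable_itv _ _ (@truncate_continuous n)) H.
have -> : x + 2 * Ni n - (x + Ni n) = Ni n by ring.
rewrite /smoothing; set I := Rintegral _ _ _ => HI.
have -> : N n * I - l = N n * (I - l * Ni n).
  by rewrite mulrBr mulrCA mulfV ?mulr1// lt0r_neq0.
by rewrite normrM gtr0_norm// mulrC -ler_pdivlMr// -/(Ni n).
Qed.

Lemma smoothing_le n x : `|smoothing n x| <= w x.
Proof.
rewrite -[smoothing n x]subr0; apply: smoothing_close => y /andP[xy _].
rewrite subr0; apply: (le_trans (truncate_le n y)); apply: (le_trans (Fw y)).
by apply: w_mono; have := Ni_gt0 n; lra.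
Qed.

Lemma continuous_uniform_on (a b e : R) : 0 < e ->
  exists2 d : R, 0 < d & forall x y, a <= x <= b -> `|x - y| <= d -> `|F y - F x| <= e.
Proof.
move=> e0; have /compact_near_coveringP cov := @segment_compact _ a b.
pose P d x := forall y, `|x - y| <= d -> `|F y - F x| <= e.
have : \forall d \near (0 : R)^'+, `[a, b]%classic `<=` P d.
  apply: cov => x _; have e2 : 0 < e / 2 by rewrite divr_gt0.
  have /cvgrPdist_lt/(_ _ e2)[r /= r0 hr] := cF (x := x).
  have r2 : 0 < r / 2 by rewrite divr_gt0.
  exists (ball x (r / 2), [set d | d < r / 2]) => /=.
    by split; [exact: nbhsx_ballx|exact: nbhs_right_lt].
  move=> [x' d] /= [xx' dr] y x'y.
  have H1 : `|F x - F x'| < e / 2.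
    by apply: hr; rewrite /ball_/=; move: xx'; rewrite /ball/= => ?; lra.
  have H2 : `|F x - F y| < e / 2.
    apply: hr; rewrite /ball_/= -(subrK x' x) -addrA (le_lt_trans (ler_normD _ _))//.
    move: xx'; rewrite /ball/= => ?; lra.
  move: H1 H2; rewrite !ltr_distl ler_norml => /andP[? ?] /andP[? ?].
  by apply/andP; split; lra.
move=> near_d; have near0 := nbhs_right_gt (0 : R).
have [d [Pd d0]] := filter_ex (filterI near_d near0).
by exists d => // x y xab; apply: Pd; rewrite /= in_itv.
Qed.

Lemma smoothing_uniform_cvg t e : 0 < e ->
  \forall n \near \oo, forall x, 0 <= x <= t -> `|smoothing n x - F x| <= e.
Proof.
move=> e0; have [d d0 hd] := continuous_uniform_on 0 t e0.
have d2 : 0 < d / 2 by rewrite divr_gt0.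
near=> n => x x0t; apply: smoothing_close => y /andP[xy yx].
have Nid : Ni n <= d / 2.
  apply/ltW; rewrite /Ni /N; near: n.
  have /cvgrPdist_lt/(_ _ d2) := @cvg_harmonic R.
  by apply: filterS => n; rewrite sub0r normrN gtr0_norm.
have tn : t + d <= n%:R by near: n; exact: nbhs_infty_ger.
have Ni0 := Ni_gt0 n; have /andP[x0 xt] := x0t.
rewrite truncate_id; last lra.
apply: hd => //; rewrite ler_norml; apply/andP; split; lra.
Unshelve. all: by end_near. Qed.

Lemma smoothing_cvg x : 0 <= x -> smoothing n x @[n --> \oo] --> F x.
Proof.
move=> x0; apply/cvgrPdist_le => e e0; near=> n; rewrite distrC.
by near: n; have := smoothing_uniform_cvg x e0; apply: filterS => n; apply; rewrite x0 lexx.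
Unshelve. all: by end_near. Qed.

Lemma smoothing_vanish n c : (forall y, c + Ni n <= y -> truncate n y = 0) ->
  forall x, c <= x -> smoothing n x = 0.
Proof.
move=> H x cx; apply/eqP; rewrite -normr_le0 -[smoothing n x]subr0.
apply: smoothing_close => y /andP[xy _]; rewrite H ?subrr ?normr0//; lra.
Qed.

End smoothing.

(** * Absolutely continuous functions *)

Lemma lebesgue_ae_and (R : realType) (P Q : R -> Prop) :
  {ae (@lebesgue_measure R), forall t, P t} -> {ae (@lebesgue_measure R), forall t, Q t} ->
  {ae (@lebesgue_measure R), forall t, P t /\ Q t}.
Proof.
apply: filterS2; first exact: (ae_filter_ringOfSetsType (@lebesgue_measure R)).
by move=> t.
Qed.

Section primitives.
Context {R : realType}.
Notation mu := (@lebesgue_measure R).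
Variables (u P : R -> R).
Hypothesis iu : forall t, 0 <= t -> mu.-integrable `[0, t] (EFin \o u).
Hypothesis PE : forall t, 0 <= t -> P t = \int[mu]_(s in `[0, t]) u s.

Lemma primitive_sub s t : 0 <= s -> s <= t ->
  mu.-integrable `[s, t] (EFin \o u) /\ P t - P s = \int[mu]_(r in `[s, t]) u r.
Proof.
move=> s0 st; have t0 := le_trans s0 st.
have i1 : mu.-integrable `[s, t] (EFin \o u).
  apply: integrableS (iu t0) => //.
  by move=> x /=; rewrite !in_itv/= => /andP[sx ->]; rewrite (le_trans s0).
split => //; rewrite !PE// Rintegral_itvB// ?iu// Rintegral_itv_obnd_cbnd//.
by apply: integrableS i1 => //; exact: subset_itv_oc_cc.
Qed.

(** Lebesgue differentiation of the restrictions of [u] to [[0, n]]; the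
    exceptional null sets are countably many. *)
Lemma primitive_ae_derivable :
  {ae mu, forall t, 0 < t -> derivable P t 1 /\ derive1 P t = u t}.
Proof.
have mI (a b : R) : measurable (`[a, b] : set (measurableTypeR R)) by exact: measurable_itv.
pose un (n : nat) := u \_ `[0, n%:R].
have H : {ae mu, forall t (n : nat), 0 < t -> t < n%:R ->
    derivable P t 1 /\ derive1 P t = u t}.
  apply/ae_foralln => n.
  have iun : mu.-integrable setT (EFin \o un n).
    have := iu (ler0n R n); rewrite (integrable_mkcond _ (mI _ _)).
    by apply: eq_integrable => // x _; rewrite /= /un restrict_EFin.
  have iy (y : R) : mu.-integrable [set` Interval (BLeft 0) (BRight y)] (EFin \o un n).
    exact: (integrableS measurableT (mI 0 y) (@subsetT _ _) iun).
  have loc : locally_integrable setT (un n) by apply: open_integrable_locally => //; exact: openT.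
  have := FTC1 iy loc; apply: filterS; first exact: (ae_filter_ringOfSetsType mu).
  move=> t Ht t0 tn.
  have [|dF FE] := Ht; first by rewrite (@lte_fin R).
  have E : \forall y \near t, \int[mu]_(r in [set` `[0, y]]) un n r = P y.
    near=> y.
    have y0 : 0 <= y by apply/ltW; near: y; exact: lt_nbhsr.
    have yn : y <= n%:R by apply/ltW; near: y; exact: lt_nbhsl.
    rewrite PE//; apply: eq_Rintegral => r; rewrite inE/= in_itv/= => /andP[r0 ry].
    by rewrite /un patchE mem_set//= in_itv/= r0 (le_trans ry).
  split; first exact: near_eq_derivable E dF.
  have tu : un n t = u t by rewrite /un patchE mem_set//= in_itv/= ?ltW.
  by rewrite -tu -FE !derive1E; apply: near_eq_derive; near do apply/esym.
move: H; apply: filterS; first exact: (ae_filter_ringOfSetsType mu).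
move=> t Ht t0; apply: (Ht (Num.truncn t).+1) => //.
exact: truncnS_gt.
Unshelve. all: by end_near. Qed.

Lemma primitive_absolutely_continuous : absolutely_continuous P.
Proof.
move=> T T0 e e0.
have mI : measurable (`[0, T] : set (measurableTypeR R)) by exact: measurable_itv.
pose uT := u \_ `[0, T].
have iuT : mu.-integrable setT (EFin \o uT).
  have := iu T0; rewrite (integrable_mkcond _ mI).
  by apply: eq_integrable => // x _; rewrite /= /uT restrict_EFin.
have [d [d0 hd]] := integral_normr_continuous iuT e0.
exists d => // n a b ab tab sab.
pose F i : set (measurableTypeR R) := [set` `]a i, b i[].
have mF i : measurable (F i) by exact: measurable_itv.
pose U := \big[setU/set0]_(i < n) F i.
have mU : measurable U by exact: bigsetU_measurable.
have muU : (mu U < d%:E)%E.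
  rewrite /U measure_bigsetU_ord// (eq_bigr (fun i => (b i - a i)%:E)).
    by rewrite sumEFin lte_fin.
  move=> i _; have [_ abi _] := ab i.
  rewrite [LHS](lebesgue_measure_itv `]a i, b i[)/= lte_fin; case: ltP => // ba.
  by rewrite (_ : b i = a i) ?subrr//; exact/le_anti/andP.
apply: le_lt_trans (hd _ mU muU).
have inorm : mu.-integrable setT (EFin \o (fun x => `|uT x|)) by exact: (integrable_abse iuT).
have fin_int (A : set (measurableTypeR R)) : measurable A ->
    mu.-integrable A (EFin \o (fun x => `|uT x|)).
  by move=> mA; exact: (integrableS measurableT mA (@subsetT _ _) inorm).
have E : \int[mu]_(x in U) `|uT x| = \sum_(i < n) \int[mu]_(x in F i) `|uT x|.
  rewrite /Rintegral integral_bigsetU_EFin//; first last.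
  - exact: (measurable_int _ (fin_int _ mU)).
  - by move=> i j _ _; exact: tab.
  - exact: index_enum_uniq.
  rewrite sum_fine// => i _; exact: (integrable_fin_num _ (fin_int _ (mF i))).
rewrite E; apply: ler_sum => i _; have [a0 abi bT] := ab i.
have [iab ->] := primitive_sub a0 abi.
have mab : measurable (`[a i, b i] : set (measurableTypeR R)) by exact: measurable_itv.
apply: le_trans (le_normr_Rintegral mab iab) _.
have -> : \int[mu]_(x in F i) `|uT x| = \int[mu]_(x in `[a i, b i]) `|uT x|.
  rewrite -[RHS]Rintegral_itv_obnd_cbnd; last first.
    by apply: fin_int; exact: measurable_itv.
  by rewrite -[RHS]Rintegral_itv_bndo_bndc//; apply: fin_int; exact: measurable_itv.
rewrite le_eqVlt; apply/orP; left; apply/eqP; apply: eq_Rintegral => x.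
rewrite inE/= in_itv/= => /andP[ax xb]; rewrite /uT patchE mem_set//= in_itv/=.
by rewrite (le_trans a0)//= (le_trans xb).
Qed.

Hypothesis u0 : forall s, 0 <= s -> 0 <= u s.

Lemma primitive_mono s t : 0 <= s -> s <= t -> P s <= P t.
Proof.
move=> s0 st; have [_ E] := primitive_sub s0 st.
rewrite -subr_ge0 E; apply: Rintegral_ge0 => r /=; rewrite in_itv/= => /andP[sr _].
by apply: u0; exact: le_trans sr.
Qed.

End primitives.

Section absolute_continuity.
Context {R : realType}.
Implicit Types f k : R -> R.

Lemma absolutely_continuous_modulus f T e : absolutely_continuous f ->
  0 <= T -> 0 < e -> exists2 d : R, 0 < d &
  forall a b, 0 <= a -> a <= b -> b <= T -> b - a < d -> `|f b - f a| < e.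
Proof.
move=> af T0 e0; have [d d0 hd] := af T T0 e e0; exists d => // a b a0 ab bT bad.
have := hd 1%N (fun=> a) (fun=> b); rewrite !big_ord1; apply => //.
by move=> i j _ _ _; rewrite [i]ord1 [j]ord1.
Qed.

Lemma absolutely_continuous_continuous f t : absolutely_continuous f ->
  0 < t -> {for t, continuous f}.
Proof.
move=> af t0; apply/cvgrPdist_lt => e e0.
have T0 : 0 <= t + 1 by rewrite ltW// addr_gt0.
have [d d0 hd] := absolutely_continuous_modulus af T0 e0.
near=> y.
have y0 : 0 < y by near: y; exact: lt_nbhsr.
have yT : y < t + 1 by near: y; apply: lt_nbhsl; rewrite ltrDl.
have yt : `|t - y| < d by near: y; exists d.
have [ty|/ltW ty] := leP t y.
  by rewrite distrC hd// ?ltW//; move: yt; rewrite distrC ger0_norm ?subr_ge0.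
by rewrite hd// ?ltW// ?ltrDl//; move: yt; rewrite ger0_norm ?subr_ge0.
Unshelve. all: by end_near. Qed.

End absolute_continuity.

Section lebesgue_affine.
Context {R : realType}.
Notation mu := (@lebesgue_measure R).

(** The push-forward by [phi] agrees with Lebesgue measure on half-open
    intervals, which determines it. *)
Lemma lebesgue_measure_preimage (phi : measurableTypeR R -> measurableTypeR R)
    (A : set (measurableTypeR R)) :
  measurable_fun (setT : set (measurableTypeR R)) phi -> measurable A ->
  (forall a b : R, a <= b -> mu (phi @^-1` [set` `]a, b]]) = (b - a)%:E) ->
  mu (phi @^-1` A) = mu A.
Proof.
move=> mphi mA phiE.
pose m : {measure set (measurableTypeR R) -> \bar R} := pushforward mu phi.
rewrite [RHS](@lebesgue_measure_unique R (m mphi))// => X /ocitvP[->|[[a b] /= ab ->]].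
  by rewrite !measure0.
rewrite /m/= /pushforward phiE ?ltW//.
by rewrite lebesgue_measure_itv/= lte_fin ab EFinB.
Qed.

Lemma lebesgue_measure_translation (t : R) (A : set (measurableTypeR R)) : measurable A ->
  mu ((fun x => x + t) @^-1` A) = mu A.
Proof.
move=> mA; apply: lebesgue_measure_preimage => //.
  apply: continuous_measurable_fun => x.
  by apply: cvgD; [exact: cvg_id|exact: cvg_cst].
move=> a b ab; rewrite (_ : _ @^-1` _ = [set` `]a - t, b - t]]); last first.
  by apply/seteqP; split => x /=; rewrite !in_itv/= ltrBlDr lerBrDr.
rewrite lebesgue_measure_itv/= lte_fin ltrD2r; case: ltP => [_|ba].
  by rewrite -EFinB; congr EFin; ring.
by rewrite (_ : b = a) ?subrr//; exact/le_anti/andP.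
Qed.

Lemma lebesgue_measure_reflection (t : R) (A : set (measurableTypeR R)) : measurable A ->
  mu ((fun x => t - x) @^-1` A) = mu A.
Proof.
move=> mA; apply: lebesgue_measure_preimage => //.
  apply: continuous_measurable_fun => x.
  by apply: cvgB; [exact: cvg_cst|exact: cvg_id].
move=> a b ab; rewrite (_ : _ @^-1` _ = [set` `[t - b, t - a[]); last first.
  apply/seteqP; split => x /=; rewrite !in_itv/= => /andP[? ?]; apply/andP; split; lra.
rewrite lebesgue_measure_itv/= lte_fin ltrD2l ltrN2; case: ltP => [_|ba].
  by rewrite -EFinB; congr EFin; ring.
by rewrite (_ : b = a) ?subrr//; exact/le_anti/andP.
Qed.

End lebesgue_affine.

Section ac_open.
Context {R : realType}.
Notation mu := (@lebesgue_measure R).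

(** The lengths of disjoint intervals add up to the measure of their union,
    hence one bound on the measure of [V] controls all families inside [V]. *)
Lemma absolutely_continuous_small_cover (k : R -> R) (T e : R) :
  absolutely_continuous k -> 0 <= T -> 0 < e -> exists2 d : R, 0 < d &
  forall V : set (measurableTypeR R), measurable V -> (mu V < d%:E)%E ->
  forall n (a b : 'I_n -> R), (forall i, [/\ 0 <= a i, a i <= b i & b i <= T]) ->
    trivIset setT (fun i => [set` `]a i, b i[]) ->
    (forall i, [set` `]a i, b i[] `<=` V) ->
    \sum_(i < n) `|k (b i) - k (a i)| < e.
Proof.
move=> ack T0 e0; have [d d0 hd] := ack T T0 e e0.
exists d => // V mV Vd n a b ab tab abV; apply: hd => //.
pose F i : set (measurableTypeR R) := [set` `]a i, b i[].
have mF i : measurable (F i) by exact: measurable_itv.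
pose U := \big[setU/set0]_(i < n) F i.
have mU : measurable U by exact: bigsetU_measurable.
have E : mu U = (\sum_(i < n) (b i - a i))%:E.
  rewrite /U measure_bigsetU_ord// (eq_bigr (fun i => (b i - a i)%:E)) ?sumEFin//.
  move=> i _; have [_ abi _] := ab i.
  rewrite [LHS](lebesgue_measure_itv `]a i, b i[)/= lte_fin; case: ltP => // ba.
  by rewrite (_ : b i = a i) ?subrr//; exact/le_anti/andP.
rewrite -lte_fin -E; apply: le_lt_trans Vd; apply: le_measure; rewrite ?inE//.
rewrite /U -bigcup_seq; apply: bigcup_sub => i _; exact: abV.
Qed.

Lemma lebesgue_null_open_cover (N : set (measurableTypeR R)) (d : R) :
  measurable N -> mu N = 0%E -> 0 < d ->
  exists V : set R, [/\ open V, N `<=` V & (mu V < d%:E)%E].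
Proof.
move=> mN N0 d0; have N_fin : (mu N < +oo)%E by rewrite [X in (X < _)%E]N0 ltry.
have [V [oV NV VN]] := lebesgue_regularity_outer mN N_fin d0.
exists V; split => //.
have mV : measurable (V : set (measurableTypeR R)) by exact: open_measurable.
have mVN : measurable (V `\` N : set (measurableTypeR R)) by exact: measurableD.
apply: le_lt_trans VN; have := measureU2 mu mN mVN.
by rewrite setDUK// [X in (_ <= X + _)%E -> _]N0 add0e.
Qed.

End ac_open.

Section stieltjes_density.
Context {R : realType}.
Notation mu := (@lebesgue_measure R).
Variables (k : R -> R) (T : R).
Hypothesis T0 : 0 <= T.
Hypothesis ack : absolutely_continuous k.
Hypothesis mk : forall s t, 0 <= s -> s <= t -> k s <= k t.

Definition clamp (x : R) : R := Num.max 0 (Num.min x T).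

Lemma clamp_ge0 x : 0 <= clamp x. Proof. by rewrite le_max lexx. Qed.
Lemma clamp_le x : clamp x <= T. Proof. by rewrite ge_max T0 ge_min lexx orbT. Qed.
Lemma clamp_mono x y : x <= y -> clamp x <= clamp y.
Proof.
rewrite /clamp; have [?|?] := leP x T; have [?|?] := leP y T;
  have [?|?] := leP 0 x; have [?|?] := leP 0 y; have [?|?] := leP 0 T; lra.
Qed.
Lemma clamp_lip x y : x <= y -> clamp y - clamp x <= y - x.
Proof.
rewrite /clamp; have [?|?] := leP x T; have [?|?] := leP y T;
  have [?|?] := leP 0 x; have [?|?] := leP 0 y; have [?|?] := leP 0 T; lra.
Qed.
Lemma clamp_id x : 0 <= x <= T -> clamp x = x.
Proof. by move=> /andP[x0 xT]; rewrite /clamp min_l// max_r. Qed.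
Lemma clamp_gt x z : 0 <= z <= T -> clamp x < z -> x < z.
Proof.
move=> /andP[z0 zT]; rewrite /clamp; have [?|?] := leP x T; have [?|?] := leP 0 x;
  have [?|?] := leP 0 T; lra.
Qed.
Lemma clamp_lt x z : 0 <= z <= T -> z < clamp x -> z < x.
Proof.
move=> /andP[z0 zT]; rewrite /clamp; have [?|?] := leP x T; have [?|?] := leP 0 x;
  have [?|?] := leP 0 T; lra.
Qed.

(** The extension of [k] by constants outside [[0, T]]: its Stieltjes measure
    carries no mass there, so that it is finite. *)
Definition clamped (x : R) : R := k (clamp x).

Let clamped_nd : {homo clamped : x y / x <= y}.
Proof. by move=> x y xy; apply: mk; [exact: clamp_ge0|exact: clamp_mono]. Qed.

Let clamped_rc : right_continuous clamped.
Proof.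
move=> x; apply/cvgrPdist_lt => e e0.
have [d d0 hd] := absolutely_continuous_modulus ack T0 e0.
near=> y; have xy : x <= y by apply/ltW; near: y; exact: nbhs_right_gt.
rewrite distrC; apply: hd.
- exact: clamp_ge0.
- exact: clamp_mono.
- exact: clamp_le.
- apply: (le_lt_trans (clamp_lip xy)); rewrite ltrBlDl.
  by near: y; apply: nbhs_right_lt; rewrite ltrDl.
Unshelve. all: by end_near. Qed.

#[local] HB.instance Definition _ :=
  isCumulative.Build R _ R clamped clamped_nd clamped_rc.

Let m : {measure set (measurableTypeR R) -> \bar R} :=
  lebesgue_stieltjes_measure clamped.

Let m_itv (a b : R) : a <= b -> m [set` `]a, b]] = (clamped b - clamped a)%:E.
Proof.
move=> ab; rewrite /m /= /lebesgue_stieltjes_measure /measure_extension/=.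
by rewrite measurable_mu_extE/= ?wlength_itv_bnd//; exact: is_ocitv.
Qed.

Let W : set (measurableTypeR R) := [set` `]0, T]].
Let mW : measurable W. Proof. exact: measurable_itv. Qed.
Let W_fin : (m W < +oo)%E. Proof. by rewrite m_itv// ltry. Qed.

Let rho : {finite_measure set (measurableTypeR R) -> \bar R} := mfrestr mW W_fin.

Let rho_itv t : 0 <= t -> rho [set` `]0, t]] = (clamped t - clamped 0)%:E.
Proof.
move=> t0; rewrite /rho/= /mfrestr /mrestr.
have -> : `]0, t]%classic `&` W = [set` `]0, Num.min t T]].
  apply/seteqP; split => x; rewrite /W /= !in_itv/= le_min.
    by move=> [/andP[-> ->] /andP[_ ->]].
  by move=> /and3P[-> -> ->].
transitivity (m [set` `]0, Num.min t T]]); first by [].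
rewrite m_itv ?le_min ?t0 ?T0// /clamped.
by rewrite (_ : clamp (Num.min t T) = clamp t)// /clamp -minA minxx.
Qed.

(* A null set has an open cover of small measure, whose components are
   disjoint intervals; the variation of [k] over finitely many of them is
   small by absolute continuity, and their total mass is the supremum over
   such finite subfamilies. *)
Let rho_dominated : rho `<< mu.
Proof.
apply/null_content_dominatesP => N mN N0.
apply/eqP; rewrite eq_le measure_ge0 andbT; apply/lee_addgt0Pr => e e0.
rewrite add0e.
have [d d0 hd] := absolutely_continuous_small_cover ack T0 e0.
have [V [oV NV muV]] := lebesgue_null_open_cover mN N0 d0.
(* Cut down to a bounded set, each non-empty component is an interval
   between its infimum and its supremum. *)
pose U : set (measurableTypeR R) := V `&` [set` `]-1, T + 1[].
have mV : measurable (V : set (measurableTypeR R)) by exact: open_measurable.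
have mU : measurable U by apply: measurableI => //; exact: measurable_itv.
have muU : (mu U < d%:E)%E.
  by apply: le_lt_trans muV; apply: le_measure; rewrite ?inE//; exact: subIsetl.
have oU : open (U : set R) by apply: openI => //; exact: interval_open.
pose I := open_disjoint_itv oU.
have IU q : I q `<=` U.
  by rewrite [X in _ `<=` X](open_disjoint_itv_bigcup oU); exact: bigcup_sup.
have oI q : open (I q) by exact: open_disjoint_itv_open.
have mI q : measurable (I q : set (measurableTypeR R)) by exact: (open_measurable (oI q)).
have I_lb q : has_lbound (I q).
  by exists (-1) => x /IU [_ /=]; rewrite in_itv/= => /andP[/ltW].
have I_ub q : has_ubound (I q).
  by exists (T + 1) => x /IU [_ /=]; rewrite in_itv/= => /andP[_ /ltW].
have IE q : I q = `]inf (I q), sup (I q)[%classic.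
  have := interval_bounded_interior (@open_disjoint_itv_is_interval _ _ oU q) (I_lb q) (I_ub q).
  rewrite (interior_id _).1; last exact: oI.
  by move=> e1; rewrite [LHS]e1; apply/seteqP; split => x /=; rewrite in_itv.
pose a q := clamp (inf (I q)).
(* For an empty component [inf] and [sup] are default values; the maximum
   keeps the end points in order there. *)
pose b q := Num.max (a q) (clamp (sup (I q))).
have bE q : I q !=set0 -> inf (I q) <= sup (I q) /\ b q = clamp (sup (I q)).
  move=> [x Ix]; have le_is : inf (I q) <= sup (I q).
    by rewrite IE/= in_itv/= in Ix; have /andP[? ?] := Ix; lra.
  by split => //; rewrite /b max_r//; exact: clamp_mono.
have ab q : [/\ 0 <= a q, a q <= b q & b q <= T].
  by split; [exact: clamp_ge0|rewrite le_max lexx|rewrite ge_max !clamp_le].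
have abI q : [set` `]a q, b q[] `<=` I q.
  move=> z /=; rewrite in_itv/= => /andP[az zb].
  have [a0 _ bT] := ab q.
  have z0T : 0 <= z <= T by rewrite (ltW (le_lt_trans a0 az)) (ltW (lt_le_trans zb bT)).
  rewrite IE/= in_itv/= (clamp_gt z0T az)/=.
  move: zb; rewrite /b lt_max => /orP[za|/(clamp_lt z0T)//].
  by have := lt_trans az za; rewrite ltxx.
have mIab q : (m (I q) <= (k (b q) - k (a q))%:E)%E.
  have [I0|] := eqVneq (I q) set0.
    by rewrite I0 measure0 lee_fin subr_ge0; have [a0 abq _] := ab q; exact: mk.
  move=> /set0P/bE[le_is ->]; rewrite /a -/(clamped _) -/(clamped _) -m_itv//.
  apply: le_measure; rewrite ?inE//.
  by rewrite [X in X `<=` _]IE; exact: subset_itv_oo_oc.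
have NW : (rho N <= m U)%E.
  rewrite /rho/= /mfrestr /mrestr; apply: le_measure; rewrite ?inE//.
    by apply: measurableI.
  move=> x [Nx]; rewrite /W/= in_itv/= => /andP[x0 xT]; split; first exact: NV.
  by rewrite /= in_itv/=; apply/andP; split; lra.
apply: (le_trans NW).
have UE : U = \bigcup_q I q by exact: open_disjoint_itv_bigcup.
rewrite [X in m X]UE measure_semi_bigcup//; last 2 first.
- exact: open_disjoint_itv_trivIset.
- by rewrite -UE.
apply: lime_le; first by apply: is_cvg_nneseries => n _ _; exact: measure_ge0.
apply: nearW => n; rewrite big_mkord.
apply: (@le_trans _ _ (\sum_(i < n) `|k (b i) - k (a i)|)%:E).
  rewrite -sumEFin; apply: lee_sum => i _; apply: (le_trans (mIab i)).
  by rewrite lee_fin ler_norm.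
rewrite lee_fin; apply/ltW; apply: (hd U mU muU n (fun i => a i) (fun i => b i)) => //.
- move=> i j _ _ [x [/= xi xj]]; apply/val_inj.
  have tI : trivIset setT I by exact: open_disjoint_itv_trivIset.
  by apply: tI => //; exists x; split; exact: abI.
- by move=> i; apply: subset_trans (abI i) (IU i).
Qed.

Lemma clamped_density : exists u : R -> R,
  mu.-integrable setT (EFin \o u) /\
  forall t, 0 <= t -> clamped t - clamped 0 = \int[mu]_(s in `[0, t]) u s.
Proof.
have [f [f0 ffin fi fE]] := radon_nikodym_sigma_finite rho_dominated.
exists (fine \o f).
have fEE : EFin \o (fine \o f) = f by apply/funext => x; rewrite /= fineK.
split; first by rewrite fEE.
move=> t t0.
have mI : measurable (`]0, t] : set (measurableTypeR R)) by exact: measurable_itv.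
have i1 : mu.-integrable `]0, t] (EFin \o (fine \o f)).
  by rewrite fEE; exact: (integrableS measurableT mI (@subsetT _ _) fi).
rewrite -Rintegral_itv_obnd_cbnd// /Rintegral.
rewrite [X in fine X](_ : _ = rho [set` `]0, t]]); first by rewrite rho_itv.
by rewrite fE//; apply: eq_integral => s _; rewrite /= fineK.
Qed.

End stieltjes_density.

(** The Stieltjes measure of [k] on [[0, n]] has a density by the
    Radon-Nikodym theorem, so [k] is there the primitive of an integrable
    function. *)
Lemma absolutely_continuous_ae_derivable (R : realType) (k : R -> R) :
  absolutely_continuous k -> (forall s t, 0 <= s -> s <= t -> k s <= k t) ->
  {ae (@lebesgue_measure R), forall t, 0 < t -> derivable k t 1}.
Proof.
move=> ack mk.
have H : {ae (@lebesgue_measure R), forall t (n : nat), 0 < t -> t < n%:R -> derivable k t 1}.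
  apply/ae_foralln => n.
  have [u [iu uE]] := clamped_density (ler0n R n) ack mk.
  have iu' (t : R) : 0 <= t -> lebesgue_measure.-integrable `[0, t] (EFin \o u).
    move=> _; apply: (integrableS measurableT) iu => //; exact: measurable_itv.
  have := @primitive_ae_derivable _ u (fun t => clamped k n%:R t - clamped k n%:R 0) iu' uE.
  apply: filterS; first exact: (ae_filter_ringOfSetsType (@lebesgue_measure R)).
  move=> t Ht t0 tn; have [dt _] := Ht t0.
  have dc : derivable (cst (clamped k n%:R 0) : R -> R) t 1 by exact: derivable_cst.
  have := derivableD dt dc; apply: near_eq_derivable; near=> y.
  rewrite /= /GRing.add/= subrK /clamped clamp_id//.
  apply/andP; split; apply/ltW; near: y; [exact: lt_nbhsr|exact: lt_nbhsl].
move: H; apply: filterS; first exact: (ae_filter_ringOfSetsType (@lebesgue_measure R)).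
move=> t Ht t0; apply: (Ht (Num.truncn t).+1) => //.
exact: truncnS_gt.
Unshelve. all: by end_near. Qed.

(** * Sub-probability measures and their paths *)

Section time_regularity.
Context {R : realType}.
Notation mu := (@lebesgue_measure R).
Notation submeasure := (subprobability (measurableTypeR R) R).

Lemma measurable_half_line : measurable (@half_line R : set (measurableTypeR R)).
Proof.
rewrite (_ : half_line = `[0, +oo[%classic); first exact: measurable_itv.
by apply/seteqP; split => x /=; rewrite /half_line/= in_itv/= andbT.
Qed.

(** [f] is the pointwise limit of step functions: [x] is replaced by the next
    multiple of [1 / (n + 1)] strictly to its right. *)
Lemma right_continuous_measurable (f : R -> R) :
  (forall t, 0 <= t -> f s @[s --> t^'+] --> f t) ->
  measurable_fun (half_line : set (measurableTypeR R)) f.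
Proof.
move=> rcf.
pose N (n : nat) : R := n.+1%:R.
have N0 n : 0 < N n by rewrite /N.
pose u n x : R := (Num.truncn (x * N n)).+1%:R / N n.
apply: (measurable_fun_cvg (h := fun n x => f (u n x))).
  move=> n _ Y mY.
  rewrite (_ : _ `&` _ = \bigcup_(k in [set k : nat | Y (f (k.+1%:R / N n))])
     `[(k%:R / N n : R), (k.+1%:R / N n)[%classic).
    by apply: bigcup_measurable => k _; exact: measurable_itv.
  apply/seteqP; split => x /=.
    move=> [x0 Yx]; exists (Num.truncn (x * N n)) => //=.
    rewrite in_itv/= ler_pdivrMr// ltr_pdivlMr//.
    have xN : 0 <= x * N n by rewrite mulr_ge0// ltW.
    by rewrite truncnS_gt andbT truncn_le.
  move=> [k /= Yk]; rewrite in_itv/= ler_pdivrMr// ltr_pdivlMr// => /andP[kx xk].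
  have x0 : 0 <= x.
    have := le_trans (ler0n _ _) kx; by rewrite pmulr_lge0.
  split => //; rewrite /u (_ : Num.truncn _ = k)//.
  by apply/eqP; rewrite truncn_eq ?kx ?xk// mulr_ge0// ltW.
move=> x x0.
have ux n : x < u n x by rewrite /u ltr_pdivlMr// truncnS_gt.
have xu n : u n x <= x + (N n)^-1.
  rewrite /u ler_pdivrMr// mulrDl mulVf ?lt0r_neq0// -natr1 lerD2r.
  by rewrite truncn_le// mulr_ge0// ltW.
have ucv : u n x @[n --> \oo] --> x.
  apply: (@squeeze_cvgr _ _ _ _ (fun=> x) (fun n => x + (N n)^-1)).
  - by near=> n; rewrite (ltW (ux n)) xu.
  - exact: cvg_cst.
  - rewrite -[X in _ --> X]addr0; apply: cvgD; first exact: cvg_cst.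
    exact: cvg_harmonic.
apply: cvg_comp (rcf x x0).
move=> P /ucv H.
have {}H : \forall n \near \oo, x < u n x -> P (u n x) by exact: H.
rewrite nbhs_filterE /=; near=> n.
have : x < u n x -> P (u n x) by near: n.
by apply; exact: ux.
Unshelve. all: by end_near. Qed.

Variable D : set R.
Hypothesis mD : measurable (D : set (measurableTypeR R)).

Lemma submeasure_le1 (xi : submeasure) (A : set R) :
  measurable (A : set (measurableTypeR R)) -> (xi A <= 1)%E.
Proof.
move=> mA; have xi1 : (xi [set: measurableTypeR R] <= 1)%E by exact: sprobability_setT.
by apply: le_trans xi1; apply: le_measure; rewrite ?inE.
Qed.

Lemma submeasure_fin_num (xi : submeasure) (A : set R) :
  measurable (A : set (measurableTypeR R)) -> xi A \is a fin_num.
Proof.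
move=> mA; rewrite ge0_fin_numE//.
exact: le_lt_trans (submeasure_le1 xi mA) (ltry 1).
Qed.

Lemma pairing_integrable (f : R -> R) (xi : submeasure) :
  bounded_continuous_on D f -> xi.-integrable D (EFin \o f).
Proof.
move=> [cf [B fB]]; apply: measurable_bounded_integrable => //.
- exact: le_lt_trans (submeasure_le1 xi mD) (ltry 1).
- exact: subspace_continuous_measurable_fun.
- exists B; split; first exact: num_real.
  by move=> M BM x Dx; apply: le_trans (fB x Dx) (ltW BM).
Qed.

Lemma pairing_norm_le (f : R -> R) (xi : submeasure) B : 0 <= B ->
  {within D, continuous f} -> (forall x, D x -> `|f x| <= B) ->
  `|pairing D f xi| <= B.
Proof.
move=> B0 cf fB.
have fi : xi.-integrable D (EFin \o f) by apply: pairing_integrable; split; last exists B.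
apply: le_trans (le_normr_Rintegral mD fi) _.
have ci : xi.-integrable D (EFin \o cst B).
  apply: (@pairing_integrable (cst B)); split; last by exists B => x _; rewrite ger0_norm.
  by apply: continuous_subspaceT => x; exact: cvg_cst.
apply: (@le_trans _ _ (\int[xi]_(x in D) B)).
  apply: le_Rintegral => //; exact: (integrable_abse fi).
rewrite Rintegral_cst// ler_piMr// -lee_fin fineK ?submeasure_fin_num//.
exact: submeasure_le1.
Qed.

Section family.
Variables (k : R -> R -> R) (c : R) (nu : R -> submeasure).
Hypothesis D0c : forall x, 0 <= x <= c -> D x.
Hypothesis D_ge0 : forall x, D x -> 0 <= x.
Hypothesis k_cont :
  {within D `*` half_line, continuous (fun p : R * R => k p.1 p.2)}.
Hypothesis k_supp : forall x s, D x -> 0 <= s -> c < x -> k x s = 0.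

Lemma family_slice_continuous s : 0 <= s -> {within D, continuous (k ^~ s)}.
Proof.
move=> s0; apply/subspace_continuousP => x Dx.
move/subspace_continuousP : k_cont => /(_ (x, s)) /(_ (conj Dx s0)) kc.
apply: (@cvg_comp _ _ _ (fun y => (y, s)) (fun p : R * R => k p.1 p.2)) kc.
move=> P [[A B] /= [nA nB] AB].
near=> y; have Ay : A y by near: y; exact: cvg_within.
have Dy : D y by near: y; exact: withinT.
exact: (AB (y, s) (conj Ay (nbhs_singleton nB)) (conj Dy s0)).
Unshelve. all: by end_near. Qed.

Lemma family_bounded t : exists2 B : R, 0 <= B &
  forall x s, D x -> 0 <= s <= t -> `|k x s| <= B.
Proof.
have cK : compact (`[0, c]%classic `*` `[0, t]%classic : set (R * R)).
  by apply: compact_setX; exact: segment_compact.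
have := continuous_compact _ cK => /(_ _ (fun p : R * R => k p.1 p.2)) H.
have /H /compact_bounded[B [_ HB]] :
    {within `[0, c]%classic `*` `[0, t]%classic, continuous (fun p : R * R => k p.1 p.2)}.
  apply: continuous_subspaceW k_cont => -[x s] /= [].
  by rewrite !in_itv/= => x0c /andP[s0 _]; split => //; exact: D0c.
exists (`|B| + 1) => [|x s Dx /andP[s0 st]]; first by rewrite addr_ge0.
have [xc|cx] := leP x c; last by rewrite k_supp// normr0 addr_ge0.
apply: (HB (`|B| + 1)); first by rewrite ltr_pwDr// ler_norm.
exists (x, s) => //; split; rewrite /= in_itv/= ?s0 ?st//.
by rewrite xc D_ge0.
Qed.

Lemma family_slice_bounded s : 0 <= s -> bounded_continuous_on D (k ^~ s).
Proof.
move=> s0; split; first exact: family_slice_continuous.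
have [B _ kB] := family_bounded s; exists B => x Dx; apply: kB => //.
by rewrite s0 lexx.
Qed.

(** Joint continuity is uniform over the compact set [[0, c]] outside which
    the family vanishes. *)
Lemma family_equicontinuous (s0 e : R) : 0 <= s0 -> 0 < e ->
  \forall s \near s0^'+, forall x, D x -> `|k x s - k x s0| <= e.
Proof.
move=> s00 e0.
have /compact_near_coveringP/near_covering_withinP cov := @segment_compact _ 0 c.
pose P s x := `|k x s - k x s0| <= e.
have : \forall s \near s0^'+, `[0, c]%classic `<=` P s.
  apply: cov => x; rewrite /= in_itv/= => x0c.
  move/subspace_continuousP : k_cont => /(_ (x, s0)) /(_ (conj (D0c x0c) s00)).
  move=> /cvgrPdist_lt/(_ _ (divr_gt0 e0 (@ltr0Sn R 1))).
  move=> [[A B] /= [nA nB] AB].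
  exists (A, [set s | B s /\ s0 < s]) => /=.
    split => //; apply: filterI; first exact: cvg_within.
    exact: nbhs_right_gt.
  move=> [y s] /= [Ay [Bs ss0]]; rewrite in_itv/= => y0c.
  have Dy := D0c y0c.
  have H1 : `|k x s0 - k y s| < e / 2.
    exact: (AB (y, s) (conj Ay Bs) (conj Dy (le_trans s00 (ltW ss0)))).
  have H2 : `|k x s0 - k y s0| < e / 2.
    exact: (AB (y, s0) (conj Ay (nbhs_singleton nB)) (conj Dy s00)).
  move: H1 H2; rewrite /P /= !ltr_distl ler_norml => /andP[? ?] /andP[? ?].
  by apply/andP; split; lra.
move=> near_s; near=> s.
have ss0 : 0 <= s by apply: (le_trans s00); apply/ltW; near: s; exact: nbhs_right_gt.
move=> x Dx; have [xc|cx] := leP x c; last first.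
  by rewrite !k_supp// subrr normr0 ltW.
have : `[0, c]%classic `<=` P s by near: s.
by apply; rewrite /= in_itv/= D_ge0.
Unshelve. all: by end_near. Qed.

(** The variation of the integrand with [s] is uniform in [x], hence harmless
    for measures of mass at most 1; what remains is the weak right-continuity
    of [nu] against one fixed function. *)
Lemma pairing_family_right_continuous s0 : 0 <= s0 -> weak_cadlag D nu ->
  pairing D (k ^~ s) (nu s) @[s --> s0^'+] --> pairing D (k ^~ s0) (nu s0).
Proof.
move=> s00 [rc _]; apply/cvgrPdist_le => e e0.
have e2 : 0 < e / 2 by rewrite divr_gt0.
have k0 := family_slice_bounded s00.
have /cvgrPdist_le/(_ _ e2) near1 := rc _ s00 _ k0.
have near2 := family_equicontinuous s00 e2.
near=> s; have ss0 : 0 <= s by apply: (le_trans s00); apply/ltW; near: s; exact: nbhs_right_gt.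
have ks := family_slice_bounded ss0.
have H1 : `|pairing D (k^~ s0) (nu s0) - pairing D (k^~ s0) (nu s)| <= e / 2.
  by near: s.
have H2 : `|pairing D (fun x => k x s - k x s0) (nu s)| <= e / 2.
  apply: pairing_norm_le; first exact: ltW.
    have := family_slice_continuous ss0; have := family_slice_continuous s00.
    by move=> c1 c2 x; apply: cvgB; [exact: c2|exact: c1].
  by near: s.
have E : pairing D (fun x => k x s - k x s0) (nu s) =
    pairing D (k^~ s) (nu s) - pairing D (k^~ s0) (nu s).
  by rewrite /pairing RintegralB//; exact: pairing_integrable.
rewrite E in H2; move: H1 H2; rewrite !ler_norml => /andP[? ?] /andP[? ?].
by apply/andP; split; lra.
Unshelve. all: by end_near. Qed.

Lemma pairing_family_integrable t : 0 <= t -> weak_cadlag D nu ->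
  mu.-integrable `[0, t] (EFin \o (fun s => pairing D (k ^~ s) (nu s))).
Proof.
move=> t0 wc.
have sub0 : `[0, t]%classic `<=` @half_line R.
  by move=> s /=; rewrite in_itv/= => /andP[].
apply: measurable_bounded_integrable => //.
- by rewrite /= lebesgue_measure_itv/=; case: ifP; rewrite -?EFinB ltry.
- apply: measurable_funS (right_continuous_measurable _) => //.
    exact: measurable_half_line.
  by move=> s s0; exact: pairing_family_right_continuous.
- have [B B0 kB] := family_bounded t.
  exists B; split; first exact: num_real.
  move=> M BM s /= st; apply: le_trans (ltW BM).
  have s0 := sub0 _ st; rewrite in_itv/= in st.
  by apply: pairing_norm_le => //; [exact: family_slice_continuous|move=> x Dx; exact: kB].
Qed.

End family.

End time_regularity.

Section submeasures.
Context {R : realType}.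
Notation mu := (@lebesgue_measure R).
Notation submeasure := (subprobability (measurableTypeR R) R).

Lemma pairing_bounded_cvg (D : set R) (xi : submeasure) (f_ : nat -> R -> R) (f : R -> R) (B : R) :
  measurable (D : set (measurableTypeR R)) ->
  (forall n, {within D, continuous (f_ n)}) ->
  (forall n x, D x -> `|f_ n x| <= B) ->
  (forall x, D x -> f_ n x @[n --> \oo] --> f x) ->
  pairing D (f_ n) xi @[n --> \oo] --> pairing D f xi.
Proof.
move=> mD cf fB ff.
have mf n : measurable_fun (D : set (measurableTypeR R)) (f_ n).
  by apply: subspace_continuous_measurable_fun => //; exact: cf.
have mff : measurable_fun (D : set (measurableTypeR R)) f by exact: measurable_fun_cvg mf ff.
have iB : xi.-integrable D (EFin \o cst B).
  apply: pairing_integrable => //; split; last by exists `|B|.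
  by apply: continuous_subspaceT => x; exact: cvg_cst.
have ae1 : {ae xi, forall x, D x -> (EFin \o f_ n) x @[n --> \oo] --> (EFin \o f) x}.
  apply: aeW => x Dx; apply: cvg_EFin; first exact: nearW.
  exact: ff.
have ae2 : {ae xi, forall x n, D x -> (`|(EFin \o f_ n) x| <= (EFin \o cst B) x)%E}.
  by apply: aeW => x n Dx; exact: fB.
have [iff _ H] := @dominated_convergence _ _ _ xi D mD
  (fun n => EFin \o f_ n) (EFin \o f) (EFin \o cst B)
  (fun n => (measurable_EFinP _ _).2 (mf n)) ((measurable_EFinP _ _).2 mff)
  ae1 iB ae2.
rewrite /pairing /Rintegral; apply: fine_cvg.
rewrite fineK//; exact: integrable_fin_num iff.
Qed.

(** The Radon-Nikodym density is integrable, and the integral of an integrable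
    function is small over small sets. *)
Lemma submeasure_dominated_modulus (xi : submeasure) e : xi `<< mu -> 0 < e ->
  exists2 d : R, 0 < d & forall A : set (measurableTypeR R), measurable A ->
    (mu A < d%:E)%E -> (xi A < e%:E)%E.
Proof.
move=> xim e0.
have [f [f0 ffin fi fE]] := radon_nikodym_sigma_finite xim.
have fEE : EFin \o (fine \o f) = f by apply/funext => x; rewrite /= fineK.
have iF : mu.-integrable setT (EFin \o (fine \o f)) by rewrite fEE.
have [d [d0 hd]] := integral_normr_continuous iF e0.
exists d => // A mA Ad; have := hd A mA Ad.
rewrite fE// -lte_fin; apply: le_lt_trans.
have iA : mu.-integrable A f by exact: (integrableS measurableT mA (@subsetT _ _) fi).
rewrite /Rintegral.
rewrite [X in (_ <= (fine X)%:E)%E](_ : _ = \int[mu]_(x in A) f x)%E; last first.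
  by apply: eq_integral => x _; rewrite /= ger0_norm ?fineK ?fine_ge0.
by rewrite fineK//; exact: integrable_fin_num iA.
Qed.

End submeasures.

Section measure_determination.
Context {R : realType}.
Notation submeasure := (subprobability (measurableTypeR R) R).
Variable D : set R.
Hypothesis mD : measurable (D : set (measurableTypeR R)).

Lemma ray_bump_cvg (c x : R) :
  Num.min 1 (n%:R * Num.max 0 (c - x)) @[n --> \oo] --> (\1_`]-oo, c[%classic x : R).
Proof.
rewrite indicE; apply: cvg_near_cst; have [xc|cx] := ltP x c.
  rewrite mem_set/=; last by rewrite in_itv.
  near=> n; rewrite max_r ?subr_ge0 ?(ltW xc)// min_l// -ler_pdivrMr ?subr_gt0//.
  by near: n; exact: nbhs_infty_ger.
rewrite memNset/=; last by rewrite in_itv/= => /(le_lt_trans cx); rewrite ltxx.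
by near=> n; rewrite [Num.max _ _]max_l ?subr_le0// mulr0 min_r.
Unshelve. all: by end_near. Qed.

Lemma ray_bump_continuous (c : R) n :
  continuous (fun x : R => Num.min 1 (n%:R * Num.max 0 (c - x))).
Proof.
move=> x; apply: (@continuous_min R R (cst 1) (fun x => n%:R * Num.max 0 (c - x))).
  exact: cvg_cst.
apply: cvgM; first exact: cvg_cst.
apply: (@continuous_max R R (cst 0) (fun x => c - x)); first exact: cvg_cst.
by apply: cvgB; [exact: cvg_cst|exact: cvg_id].
Qed.

Lemma supported_on_restrict (xi : submeasure) (A : set (measurableTypeR R)) :
  supported_on D xi -> measurable A -> xi A = xi (D `&` A).
Proof.
move=> sx mA; rewrite -[in LHS](setIT A) -(setUv D) setIUr measureU//.
- rewrite setIC (@subset_measure0 _ _ _ xi (A `&` ~` D) (~` D)) ?adde0//.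
  + by apply: measurableI => //; exact: measurableC.
  + exact: measurableC.
- exact: measurableI.
- by apply: measurableI => //; exact: measurableC.
- by rewrite setIACA setICr setI0.
Qed.

(** Integrals of continuous functions determine the masses of open rays, as
    limits of bumps, and the rays are a pi-system generating the Borel sets.
    *)
Lemma submeasure_eq (xi1 xi2 : submeasure) :
  supported_on D xi1 -> supported_on D xi2 ->
  (forall f, bounded_continuous_on half_line f -> pairing D f xi1 = pairing D f xi2) ->
  forall A : set (measurableTypeR R), measurable A -> xi1 A = xi2 A.
Proof.
move=> s1 s2 eqf.
have ray (c : R) : xi1 (D `&` `]-oo, c[) = xi2 (D `&` `]-oo, c[).
  have mI : measurable (D `&` `]-oo, c[ : set (measurableTypeR R)).
    by apply: measurableI => //; exact: measurable_itv.
  pose b n (x : R) := Num.min 1 (n%:R * Num.max 0 (c - x)).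
  have b0 n x : 0 <= b n x.
    by rewrite le_min ler01 mulr_ge0// le_max lexx.
  have b1 n x : `|b n x| <= 1 by rewrite ger0_norm// ge_min lexx.
  have H (xi : submeasure) : pairing D (b n) xi @[n --> \oo] -->
      fine (xi (D `&` `]-oo, c[)).
    have -> : fine (xi (D `&` `]-oo, c[)) = pairing D (\1_`]-oo, c[%classic) xi.
      rewrite /pairing /Rintegral integral_indic//.
      by rewrite setIC.
    apply: (@pairing_bounded_cvg _ _ _ _ _ 1) => //.
    - by move=> n; apply: continuous_subspaceT; exact: ray_bump_continuous.
    - by move=> x _; exact: ray_bump_cvg.
  have bb n : bounded_continuous_on half_line (b n).
    split; last by exists 1.
    by apply: continuous_subspaceT; exact: ray_bump_continuous.
  have H1 := H xi1; have H2 := H xi2.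
  have E : (fun n => pairing D (b n) xi1) = (fun n => pairing D (b n) xi2).
    by apply/funext => n; exact: eqf.
  rewrite E in H1.
  have e := cvg_unique (@Rhausdorff R) H1 H2.
  rewrite -(fineK (submeasure_fin_num xi1 mI)) -(fineK (submeasure_fin_num xi2 mI)).
  by congr EFin; exact: e.
pose ray_n (n : nat) : set (measurableTypeR R) := [set` `]-oo, (n%:R : R)[].
have GE : @measurable _ (measurableTypeR R) = <<s @RGenInftyO.G R >>.
  exact: RGenInftyO.measurableE.
have GI : setI_closed (@RGenInftyO.G R).
  move=> _ _ [x ->] [y ->]; exists (Num.min x y).
  apply/seteqP; split => z /=; rewrite !in_itv/= lt_min; first by move=> [-> ->].
  by move=> /andP[].
have Gn n : @RGenInftyO.G R (ray_n n) by exists n%:R.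
have cover : \bigcup_n ray_n n = setT.
  apply/seteqP; split => // x _; exists (Num.truncn `|x|).+1 => //=.
  by rewrite /ray_n/= in_itv/= (le_lt_trans (ler_norm x))// truncnS_gt.
have eqG A : @RGenInftyO.G R A -> xi1 A = xi2 A.
  by move=> [c ->]; rewrite (supported_on_restrict s1)// (supported_on_restrict s2).
have fin n : (xi1 (ray_n n) < +oo)%E.
  by apply: le_lt_trans (submeasure_le1 _ _) (ltry 1); exact: measurable_itv.
move=> A mA; have H := @measure_unique _ R (measurableTypeR R) _ ray_n GE GI Gn cover
  xi1 xi2 eqG fin A mA.
exact: H.
Qed.

End measure_determination.

Section inner_bump.
Context {R : realType}.
Variable V : set R.
Hypothesis oV : open V.
Hypothesis V_neqT : exists x, ~ V x.

Definition dist_to_compl (x : R) : R := inf [set `|x - y| | y in ~` V].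

Lemma dist_to_compl_has_inf x : has_inf [set `|x - y| | y in ~` V].
Proof.
split; first by have [y Vy] := V_neqT; exists `|x - y|, y.
by exists 0 => _ [y _ <-].
Qed.

Lemma dist_to_compl_le x y : ~ V y -> dist_to_compl x <= `|x - y|.
Proof. by move=> Vy; apply: ge_inf; [exact: (dist_to_compl_has_inf x).2|exists y]. Qed.

Lemma dist_to_compl_ge x r : (forall y, ~ V y -> r <= `|x - y|) -> r <= dist_to_compl x.
Proof.
move=> H; apply: lb_le_inf; first exact: (dist_to_compl_has_inf x).1.
by move=> _ [y Vy <-]; exact: H.
Qed.

Lemma dist_to_compl_lip x z : dist_to_compl x <= dist_to_compl z + `|x - z|.
Proof.
rewrite -lerBlDr; apply: dist_to_compl_ge => y Vy; rewrite lerBlDr.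
apply: (le_trans (dist_to_compl_le x Vy)).
by rewrite [leRHS]addrC; exact: ler_distD.
Qed.

Lemma dist_to_compl_continuous : continuous dist_to_compl.
Proof.
move=> x; apply/cvgrPdist_le => e e0; near=> z.
have xz : `|x - z| <= e by apply/ltW; near: z; exists e.
have := dist_to_compl_lip x z; have := dist_to_compl_lip z x; rewrite [`|z - x|]distrC => ? ?.
by rewrite ler_norml; apply/andP; split; lra.
Unshelve. all: by end_near. Qed.

(** Vanishes within distance [1 / n] of the complement of [V], and yet tends
    to the indicator function of [V] as [n] grows. *)
Definition inner_bump (n : nat) (x : R) : R :=
  Num.min (Num.max (n%:R * dist_to_compl x - 1) 0) 1.

Lemma inner_bump_ge0 n x : 0 <= inner_bump n x.
Proof. by rewrite le_min le_max lexx orbT ler01. Qed.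

Lemma inner_bump_le1 n x : inner_bump n x <= 1.
Proof. by rewrite ge_min lexx orbT. Qed.

Lemma inner_bump_continuous n : continuous (inner_bump n).
Proof.
move=> x.
apply: (@continuous_min R R (fun x => Num.max (n%:R * dist_to_compl x - 1) 0) (cst 1));
  last exact: cvg_cst.
apply: (@continuous_max R R (fun x => n%:R * dist_to_compl x - 1) (cst 0));
  last exact: cvg_cst.
apply: cvgB; last exact: cvg_cst.
by apply: cvgM; [exact: cvg_cst|exact: dist_to_compl_continuous].
Qed.

Lemma inner_bump_out n x : ~ V x -> inner_bump n x = 0.
Proof.
move=> Vx; have : dist_to_compl x <= 0 by have := dist_to_compl_le x Vx; rewrite subrr normr0.
move=> c0; rewrite /inner_bump max_r ?min_l//.
rewrite subr_le0; apply: (le_trans _ ler01); exact: mulr_ge0_le0.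
Qed.

Lemma inner_bump_ball n x z : inner_bump n.+1 x != 0 -> `|x - z| <= n.+1%:R^-1 -> V z.
Proof.
move=> b0 xz; apply: contrapT => Vz; move/negP : b0; apply; apply/eqP.
have c := le_trans (dist_to_compl_le x Vz) xz.
rewrite /inner_bump max_r ?min_l// subr_le0 mulrC -ler_pdivlMr//.
by rewrite div1r.
Qed.

Lemma inner_bump_cvg x : inner_bump n x @[n --> \oo] --> (\1_V x : R).
Proof.
rewrite indicE; apply: cvg_near_cst; have [Vx|Vx] := pselect (V x); last first.
  by rewrite memNset//; near=> n; exact: inner_bump_out.
rewrite mem_set//; have [r /= r0 rV] : nbhs x V by exact: open_nbhs_nbhs.
have cr : r <= dist_to_compl x.
  by apply: dist_to_compl_ge => y Vy; rewrite leNgt; apply/negP => xy; apply: Vy; exact: rV.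
near=> n; rewrite /inner_bump min_r// le_max; apply/orP; left.
rewrite lerBrDr; apply: (@le_trans _ _ (n%:R * r)); last by rewrite ler_wpM2l.
rewrite -ler_pdivrMr//; near: n; exact: nbhs_infty_ger.
Unshelve. all: by end_near. Qed.

End inner_bump.

(** * The service distribution *)

Section service_law.
Context {R : realType}.
Variables (G : cumulativeBounded (0 : R) (1 : R)) (g : R -> R).
Hypothesis Gg : cdf_with_density G g.
Let D := service_itv G.
Let h := hazard G g.
Notation mu := (@lebesgue_measure R).

Lemma law_mono x y : x <= y -> G x <= G y.
Proof. exact: (cumulative_is_nondecreasing G). Qed.

Lemma law_ge0 x : 0 <= G x.
Proof.
have [x0|x0] := ltP x 0; first by rewrite (cdf_neg Gg).
have := density_cdf Gg x0 => E; rewrite -lee_fin E.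
apply: integral_ge0 => y /=; rewrite in_itv/= lee_fin => /andP[y0 _].
exact: (density_ge0 Gg).
Qed.

Lemma law_le1 x : G x <= 1.
Proof.
have Gy := @cumulativey R 0 1 G.
rewrite leNgt; apply/negP => Gx1.
have [y [Gyx xy]] := filter_ex (filterI (cvgr_lt _ Gy _ Gx1) (nbhs_pinfty_ge (num_real x))).
by move: Gyx; rewrite ltNge law_mono.
Qed.

Lemma law0 : G 0 = 0.
Proof.
apply/EFin_inj; rewrite (density_cdf Gg)// set_itv1.
by rewrite integral_set1.
Qed.

Lemma service_itvP x : D x <-> 0 <= x /\ exists2 y, x < y & G y < 1.
Proof.
split=> [[x0 /ereal_sup_gt[_ [y [y0 Gy] <-]]]|[x0 [y xy Gy]]].
  by rewrite lte_fin => xy; split => //; exists y.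
split=> //; rewrite (@lt_le_trans _ _ y%:E)//.
apply: ereal_sup_ubound; exists y => //; split => //.
exact: le_trans (ltW xy).
Qed.

Lemma service_itv_ge0 x : D x -> 0 <= x. Proof. by case. Qed.

Lemma service_itv_lt1 x : D x -> G x < 1.
Proof.
by move=> /service_itvP[_ [y xy]]; apply: le_lt_trans; exact/law_mono/ltW.
Qed.

Lemma service_itv_right x : D x -> exists2 y, x < y & D y.
Proof.
move=> /service_itvP[x0 [y xy Gy]]; exists ((x + y) / 2); first lra.
by apply/service_itvP; split; [lra|exists y => //; lra].
Qed.

Lemma service_itv_down x y : 0 <= x -> x <= y -> D y -> D x.
Proof.
move=> x0 xy /service_itvP[_ [z yz Gz]]; apply/service_itvP; split => //.
by exists z => //; exact: le_lt_trans yz.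
Qed.

Lemma service_itv_interval : is_interval D.
Proof.
move=> x y Dx Dy z /andP[xz zy]; apply: (service_itv_down _ zy) => //.
exact: le_trans (service_itv_ge0 Dx) xz.
Qed.

Lemma measurable_service_itv : measurable (D : set (measurableTypeR R)).
Proof. exact: (is_interval_measurable service_itv_interval). Qed.

Lemma law_lt1_itv x : 0 <= x -> G x < 1 -> D x.
Proof.
move=> x0 Gx; apply/service_itvP; split => //.
have G1 : 0 < (1 - G x) / 2 by lra.
have [d] := nondecreasing_right_continuousP x G G1.
move=> Gd; exists (x + d%:num); first by rewrite ltrDl.
by apply: le_lt_trans Gd _; change (G x + (1 - G x) / 2 < 1); lra.
Qed.

Lemma law_out x : 0 <= x -> ~ D x -> G x = 1.
Proof.
move=> x0 nD; apply/le_anti; rewrite law_le1/= leNgt; apply/negP => Gx.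
exact/nD/law_lt1_itv.
Qed.

Lemma service_itv0 : D 0.
Proof. by apply: law_lt1_itv => //; rewrite law0. Qed.

Lemma survival_gt0 x : D x -> 0 < 1 - G x.
Proof. by move/service_itv_lt1; rewrite subr_gt0. Qed.

Lemma hazard_ge0 x : D x -> 0 <= h x.
Proof.
move=> Dx; apply: divr_ge0; last exact/ltW/survival_gt0.
exact/(density_ge0 Gg)/service_itv_ge0.
Qed.

Lemma density_hazard x : D x -> g x = h x * (1 - G x).
Proof. by move=> Dx; rewrite /h /hazard divfK// lt0r_neq0// survival_gt0. Qed.

Lemma density_integrable a b : 0 <= a -> a <= b ->
  mu.-integrable `[a, b] (EFin \o g).
Proof.
move=> a0 ab; have ib : mu.-integrable `[0, b] (EFin \o g).
  have s0 : `[0, b] `<=` @half_line R.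
    by move=> x /=; rewrite in_itv/= => /andP[].
  apply/integrableP; split.
    apply/measurable_EFinP; apply: measurable_funS (density_measurable Gg) => //.
    rewrite (_ : half_line = `[0, +oo[%classic); first exact: measurable_itv.
    by apply/seteqP; split => x /=; rewrite in_itv/= andbT.
  rewrite (_ : \int[mu]_(x in _) _ = (G b)%:E)%E ?ltry//.
  rewrite (density_cdf Gg) ?(le_trans a0)//; apply: eq_integral => x.
  by rewrite inE/= => /s0 /(density_ge0 Gg) gx; rewrite ger0_norm.
apply: integrableS ib => //.
by move=> x /=; rewrite !in_itv/= => /andP[ax ->]; rewrite (le_trans a0).
Qed.

Lemma law_diff a b : 0 <= a -> a <= b -> G b - G a = \int[mu]_(z in `[a, b]) g z.
Proof.
move=> a0 ab.
have cdfE x : 0 <= x -> G x = \int[mu]_(z in `[0, x]) g z.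
  by move=> x0; rewrite /Rintegral -(density_cdf Gg).
rewrite !cdfE ?(le_trans a0 ab)//.
have i0 := density_integrable (lexx 0) (le_trans a0 ab).
rewrite Rintegral_itvB// Rintegral_itv_obnd_cbnd//.
apply: integrableS (density_integrable a0 ab) => //.
exact: subset_itv_oc_cc.
Qed.

Lemma law_continuous : continuous G.
Proof.
move=> x; have [x0|x0] := ltP x 0.
  rewrite /continuous_at (cdf_neg Gg x0); apply: cvg_near_cst.
  near=> y; rewrite (cdf_neg Gg)//; near: y; exact: lt_nbhsl.
have b0 : 0 < x + 1 by rewrite ltr_wpDl.
have cdfE y : 0 <= y -> G y = \int[mu]_(z in `[0, y]) g z.
  by move=> y0; rewrite /Rintegral -(density_cdf Gg).
have := parameterized_integral_continuous (ltW b0) (density_integrable (lexx 0) (ltW b0)).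
move=> /(continuous_within_itvP _ b0)[ci _ _].
move: x0; rewrite le_eqVlt => /predU1P[<-|x0].
  apply/left_right_continuousP; split; last exact: (cumulative_is_right_continuous G).
  rewrite law0; apply: cvg_near_cst; near=> y; rewrite (cdf_neg Gg)//.
have : x \in `]0, x + 1[ by rewrite in_itv/= x0/= ltrDl ltr01.
move=> /ci; rewrite /continuous_at /parameterized_integral -cdfE ?(ltW x0)//.
apply: cvg_trans; apply: near_eq_cvg; near=> y; rewrite cdfE//.
by apply/ltW; near: y; exact: lt_nbhsr.
Unshelve. all: by end_near. Qed.

(** [g] itself need not be continuous, but it agrees on the service interval
    with the continuous function [h * (1 - G)], of which [G] is therefore a
    differentiable primitive; at 0 the derivative is one-sided. *)
Lemma survival_derivative x : {within D, continuous h} -> D x ->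
  derivative_within D (fun y => 1 - G y) x (- g x).
Proof.
move=> ch Dx; pose u y := h y * (1 - G y).
have ug y : D y -> u y = g y by move=> Dy; rewrite density_hazard.
have cu : u y @[y --> within D (nbhs x)] --> u x.
  apply: cvgM; first by move/subspace_continuousP : ch; exact.
  apply: cvgB; first exact: cvg_cst.
  by apply: cvg_within_filter; exact: law_continuous.
have dG : derivative_within D G x (g x).
  rewrite -(ug _ Dx); apply: primitive_derivative_within cu => //.
    exact: service_itv_interval.
  move=> a b Da Db ab.
  have uE : {in `[a, b], g =1 u}.
    move=> z; rewrite in_itv/= => zab; rewrite ug//.
    exact: (service_itv_interval Da Db).
  have a0 := service_itv_ge0 Da.
  rewrite law_diff//; split; last by apply: eq_Rintegral => z; rewrite inE => /uE.
  by apply: eq_integrable (density_integrable a0 ab) => // z; rewrite inE /= => /uE->.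
have : - ((G y - G x) / (y - x)) @[y --> within D x^'] --> - g x by exact: cvgN.
apply: cvg_trans; apply: near_eq_cvg; near=> y.
by rewrite -mulNr; congr (_ / _); ring.
Unshelve. all: by end_near. Qed.

End service_law.

(** * Transport of mass along characteristics *)

Section transport.
Context {R : realType}.
Notation mu := (@lebesgue_measure R).
Variables (G : cumulativeBounded (0 : R) (1 : R)) (g : R -> R).
Hypothesis Gg : cdf_with_density G g.
Let D := service_itv G.
Let h := hazard G g.
Hypothesis ch : {within D, continuous h}.
Variables (E : R -> R) (X0 : R) (nu0 : subprobability (measurableTypeR R) R).
Variables (X : R -> R) (nu : R -> subprobability (measurableTypeR R) R).
Hypothesis sol : fluid_solution D h E X0 nu0 X nu.
Let K := entries D h nu0 nu.

Lemma within_product_fst (u : R -> R) :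
  {within D, continuous u} ->
  {within D `*` half_line, continuous (fun p : R * R => u p.1)}.
Proof.
move=> /subspace_continuousP cu; apply/subspace_continuousP => -[x s] [/= Dx s0].
apply: (cvg_comp (fun p : R * R => p.1) u _ (cu x Dx)).
move=> P [e /= e0 eP].
exists (ball x e, setT) => /=; first by split; [exact: nbhsx_ballx|exact: filterT].
by move=> [y r] /= [xy _] [Dy _]; exact: eP.
Qed.

Lemma survival_inv_within : {within D, continuous (fun x => (1 - G x)^-1)}.
Proof.
apply/subspace_continuousP => x Dx; apply: cvgV.
  exact/lt0r_neq0/survival_gt0.
apply: cvgB; first exact: cvg_cst.
by apply: cvg_within_filter; exact: (law_continuous Gg).
Qed.

(** The function [F (x + t - s) * chi s / (1 - G x)] solves [phi_s + phi_x = h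
    * phi] for [s <= t], where [chi = 1]; the cut-off [chi] makes its support
    compact in time. On the characteristic through age 0 it equals [F (t -
    s)], because [G 0 = 0]. *)
Lemma transport_identity (F F' : R -> R) (c t : R) : 0 <= t ->
  (forall x : R, is_derive x 1 F (F' x)) -> continuous F' ->
  D c -> (forall x, c <= x -> F x = 0) ->
  exists2 I : R, is_RS_integral (fun s => F (t - s)) K 0 t I &
    pairing D (fun x => F x / (1 - G x)) (nu t) =
      pairing D (fun x => F (x + t) / (1 - G x)) nu0 + I.
Proof.
move=> t0 dF cF' Dc F0.
have c0 := service_itv_ge0 Dc.
(* The gap between [c] and [b] is the time during which [chi] decreases to
   0: until then a point to the right of [b] is carried to the right of
   [c]. *)
have [b cb Db] := service_itv_right Dc.
have D0b x : 0 <= x <= b -> D x by move=> /andP[x0 xb]; exact: (service_itv_down x0 xb Db).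
have d0 : 0 < b - c by rewrite subr_gt0.
have [chi [chi' [dchi cchi' chi1 chi'0 chi0]]] := smooth_cutoff t d0.
have F'0 x : c < x -> F' x = 0.
  move=> cx; have [_ <-] := dF x.
  rewrite (@near_eq_derive _ _ _ F (cst 0)) ?derive_cst//.
  near=> y; rewrite F0//; apply/ltW; near: y; exact: lt_nbhsr.
have cF : continuous F.
  by move=> x; apply: differentiable_continuous; apply/derivable1_diffP; have [] := dF x.
have cchi : continuous chi.
  by move=> x; apply: differentiable_continuous; apply/derivable1_diffP; have [] := dchi x.
pose S x := (1 - G x)^-1.
pose phi x s := F (x + (t - s)) * chi s * S x.
pose phis x s := (- F' (x + (t - s)) * chi s + F (x + (t - s)) * chi' s) * S x.
pose phix x s := (F' (x + (t - s)) * chi s + h x * (F (x + (t - s)) * chi s)) * S x.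
have carg : continuous (fun p : R * R => p.1 + (t - p.2)).
  move=> p; apply: cvgD; first exact: cvg_fst.
  apply: cvgB; first exact: cvg_cst. exact: cvg_snd.
have cT (u : R -> R) : continuous u ->
    {within D `*` half_line, continuous (fun p : R * R => u (p.1 + (t - p.2)))}.
  move=> cu; apply: continuous_subspaceT => p.
  by apply: continuous_comp; [exact: carg|exact: cu].
have c2 (u : R -> R) : continuous u ->
    {within D `*` half_line, continuous (fun p : R * R => u p.2)}.
  move=> cu; apply: continuous_subspaceT => p.
  by apply: continuous_comp; [exact: cvg_snd|exact: cu].
have cS := within_product_fst survival_inv_within.
have chp := within_product_fst ch.
have cphi : {within D `*` half_line, continuous (fun p : R * R => phi p.1 p.2)}.
  move=> p; apply: cvgM; last exact: cS.
  by apply: cvgM; [exact: (cT _ cF)|exact: (c2 _ cchi)].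
have cphis : {within D `*` half_line, continuous (fun p : R * R => phis p.1 p.2)}.
  move=> p; apply: cvgM; last exact: cS.
  apply: cvgD; apply: cvgM.
  - by apply: cvgN; exact: (cT _ cF').
  - exact: (c2 _ cchi).
  - exact: (cT _ cF).
  - exact: (c2 _ cchi').
have cphix : {within D `*` half_line, continuous (fun p : R * R => phix p.1 p.2)}.
  move=> p; apply: cvgM; last exact: cS.
  apply: cvgD; apply: cvgM.
  - exact: (cT _ cF').
  - exact: (c2 _ cchi).
  - exact: chp.
  - by apply: cvgM; [exact: (cT _ cF)|exact: (c2 _ cchi)].
have chphi : {within D `*` half_line, continuous (fun p : R * R => h p.1 * phi p.1 p.2)}.
  by move=> p; apply: cvgM; [exact: chp|exact: cphi].
have far x s : b < x -> s < t + (b - c) -> c < x + (t - s) by lra.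
have phi0 x s : b < x -> phi x s = 0.
  move=> bx; have [/(far _ _ bx) H|/chi0[H _]] := ltP s (t + (b - c)).
    by rewrite /phi F0 ?ltW// !mul0r.
  by rewrite /phi H mulr0 mul0r.
have phis0 x s : b < x -> phis x s = 0.
  move=> bx; have [/(far _ _ bx) H|/chi0[H H']] := ltP s (t + (b - c)).
    by rewrite /phis F0 ?ltW// F'0// oppr0 !mul0r addr0 mul0r.
  by rewrite /phis H H' !mulr0 addr0 mul0r.
have phix0 x s : b < x -> phix x s = 0.
  move=> bx; have [/(far _ _ bx) H|/chi0[H _]] := ltP s (t + (b - c)).
    by rewrite /phix F0 ?ltW// F'0// !mul0r mulr0 addr0 mul0r.
  by rewrite /phix H !mulr0 addr0 mul0r.
have test : test_function D phi phix phis.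
  split => //.
  - move=> x s Dx s0.
    have dFx : derivative_within D (fun y => F (y + (t - s))) x (F' (x + (t - s))).
      apply: is_derive_derivative_within.
      have d1 : is_derive x 1 (fun y => y + (t - s)) 1.
        apply: (@is_derive_quadratic _ _ _ _ 0) => e.
        by rewrite mul0r (_ : _ - _ = 0) ?normr0//; ring.
      have := @is_derive1_comp _ F (fun y => y + (t - s)) x _ _ (dF _) d1.
      by rewrite mulr1.
    have dchix : derivative_within D (fun=> chi s) x 0.
      exact: derivative_within_cst.
    have dS : derivative_within D S x (- (- g x) / (1 - G x) ^+ 2).
      apply: derivative_withinV; first exact/lt0r_neq0/survival_gt0.
      exact: survival_derivative.
    have := derivative_withinM (derivative_withinM dFx dchix) dS.
    rewrite mulr0 addr0 opprK; congr (derivative_within _ _ _ _).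
    rewrite (density_hazard g Dx) /phix /S -/h; field.
    exact/lt0r_neq0/survival_gt0.
  - move=> x s Dx s0.
    have dFs : derivative_within half_line (fun r => F (x + (t - r))) s (- F' (x + (t - s))).
      apply: is_derive_derivative_within.
      have d1 : is_derive s 1 (fun r => x + (t - r)) (-1).
        apply: (@is_derive_quadratic _ _ _ _ 0) => e.
        by rewrite mul0r (_ : _ - _ = 0) ?normr0//; ring.
      have := @is_derive1_comp _ F (fun r => x + (t - r)) s _ _ (dF _) d1.
      by rewrite mulrN1.
    have dchis : derivative_within half_line chi s (chi' s).
      exact/is_derive_derivative_within.
    have dS : derivative_within half_line (fun=> S x) s 0.
      exact: derivative_within_cst.
    have := derivative_withinM (derivative_withinM dFs dchis) dS.
    by rewrite mulr0 addr0.
  - exists (`[0, b]%classic `*` `[0, t + (b - c)]%classic); split.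
    + by apply: compact_setX; exact: segment_compact.
    + move=> [x s] /= []; rewrite !in_itv/= => /D0b Dx /andP[s0 _].
      by split.
    + move=> x s Dx s0 phin0; split; rewrite /= in_itv/=.
        rewrite (service_itv_ge0 Dx) leNgt; apply/negP => /phi0 E0.
        by rewrite E0 eqxx in phin0.
      rewrite s0 leNgt; apply/negP => /ltW/chi0[E0 _].
      by rewrite /phi E0 mulr0 mul0r eqxx in phin0.
have [I hI eqI] := fluid_age sol t0 test.
have mD := measurable_service_itv G.
have Dge0 x : D x -> 0 <= x := @service_itv_ge0 _ G x.
have wc := fluid_nu_cadlag sol.
have is_ := pairing_family_integrable mD D0b Dge0 cphis (fun x s _ _ => @phis0 x s) t0 wc.
have ix_ := pairing_family_integrable mD D0b Dge0 cphix (fun x s _ _ => @phix0 x s) t0 wc.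
have hphi0 x s : D x -> 0 <= s -> b < x -> h x * phi x s = 0.
  by move=> _ _ bx; rewrite phi0 ?mulr0.
have ih_ := pairing_family_integrable mD D0b Dge0 chphi hphi0 t0 wc.
exists I.
  apply: eq_RS_integral hI => // s /andP[s0 st].
  by rewrite /phi chi1// /S (law0 Gg) add0r subr0 invr1 !mulr1.
have E1 : pairing D (phi ^~ t) (nu t) = pairing D (fun x => F x / (1 - G x)) (nu t).
  by apply: eq_Rintegral => x _; rewrite /phi chi1// subrr addr0 mulr1.
have E2 : pairing D (phi ^~ 0) nu0 = pairing D (fun x => F (x + t) / (1 - G x)) nu0.
  by apply: eq_Rintegral => x _; rewrite /phi chi1// subr0 mulr1.
have E3 : \int[mu]_(s in `[0, t]) pairing D (phis^~ s) (nu s) +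
    \int[mu]_(s in `[0, t]) pairing D (phix^~ s) (nu s) -
    \int[mu]_(s in `[0, t]) pairing D (fun x => h x * phi x s) (nu s) = 0.
  have mI : measurable (`[0, t] : set (measurableTypeR R)) by exact: measurable_itv.
  rewrite -RintegralD// -RintegralB//; last exact: (integrableD mI is_ ix_).
  rewrite (@eq_Rintegral _ _ _ _ _ (fun=> 0)); last first.
    move=> s; rewrite inE/= in_itv/= => /andP[s0 st].
    have bs k : {within D `*` half_line, continuous (fun p : R * R => k p.1 p.2)} ->
      (forall x s, D x -> 0 <= s -> b < x -> k x s = 0) ->
      (nu s).-integrable D (EFin \o (k ^~ s)).
      move=> ck k0; apply: pairing_integrable => //.
      exact: (family_slice_bounded D0b Dge0 ck k0).
    have i1 := bs _ cphis (fun x s _ _ => @phis0 x s).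
    have i2 := bs _ cphix (fun x s _ _ => @phix0 x s).
    have i3 := bs _ chphi hphi0.
    rewrite /pairing -RintegralD// -RintegralB//; last exact: (integrableD mD i1 i2).
    rewrite (@eq_Rintegral _ _ _ _ _ (fun=> 0)); last first.
      move=> x _; rewrite /phis /phix /phi chi1// chi'0//; ring.
    by rewrite Rintegral_cst// mul0r.
  by rewrite Rintegral_cst// mul0r.
rewrite -E1 -E2 eqI; congr (_ + _).
by rewrite -[LHS]addrA -[LHS]addrA [X in _ + X]addrA E3 addr0.
Unshelve. all: by end_near. Qed.

End transport.

(** * Departures and entries *)

Section entries.
Context {R : realType}.
Notation mu := (@lebesgue_measure R).
Notation submeasure := (subprobability (measurableTypeR R) R).
Variables (G : cumulativeBounded (0 : R) (1 : R)) (g : R -> R).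
Hypothesis Gg : cdf_with_density G g.
Let D := service_itv G.
Let h := hazard G g.
Hypothesis ch : {within D, continuous h}.

Let mD : measurable (D : set (measurableTypeR R)) := measurable_service_itv G.

Lemma truncated_hazard_bounded_continuous n :
  bounded_continuous_on D (fun x => Num.min (h x) n%:R).
Proof.
split.
  by move=> x; apply: continuous_min; [exact: ch|exact: cvg_cst].
exists n%:R => x Dx; rewrite ger0_norm ?ge_min ?lexx ?orbT//.
by rewrite le_min (hazard_ge0 Gg Dx) ler0n.
Qed.

(** The hazard rate may be unbounded near the right end, so the weak topology
    says nothing about [h] itself; its truncations are admissible and monotone
    convergence recovers [h], including the measurability in time of the
    departure rate. *)
Lemma epairing_hazard_limit (xi : submeasure) :
  (pairing D (fun x => Num.min (h x) n%:R) xi)%:E @[n --> \oo] --> epairing D h xi.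
Proof.
pose hn n x : \bar R := (Num.min (h x) n%:R)%:E.
have inn n : xi.-integrable D (hn n).
  exact/pairing_integrable/truncated_hazard_bounded_continuous.
have := @cvg_monotone_convergence _ _ _ xi D mD hn.
have mhn n : measurable_fun D (hn n) by exact: (measurable_int _ (inn n)).
have hn0 n x : D x -> (0 <= hn n x)%E.
  by move=> Dx; rewrite lee_fin le_min (hazard_ge0 Gg Dx) ler0n.
have hnd x : D x -> {homo hn ^~ x : n m / (n <= m)%N >-> (n <= m)%E}.
  move=> Dx n m nm; rewrite lee_fin le_min ge_min lexx/= ge_min.
  by rewrite orbC ler_nat nm.
move=> /(_ mhn hn0 hnd).
have -> : (\int[xi]_(x in D) limn (hn ^~ x) = epairing D h xi)%E.
  apply: eq_integral => x; rewrite inE => Dx.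
  apply/cvg_lim => //; apply: cvg_near_cst; near=> n.
  rewrite /hn min_l//; near: n; exact: nbhs_infty_ger.
apply: cvg_trans; apply: near_eq_cvg; near=> n.
rewrite /pairing /Rintegral fineK//; exact: (integrable_fin_num _ (inn n)).
Unshelve. all: by end_near. Qed.

Variables (E : R -> R) (X0 : R) (nu0 : submeasure).
Variables (X : R -> R) (nu : R -> submeasure).
Hypothesis sol : fluid_solution D h E X0 nu0 X nu.
Let K := entries D h nu0 nu.
Let Dep t := fine (departures D h nu t).
Let rate s := fine (epairing D h (nu s)).

Lemma epairing_hazard_ge0 (xi : submeasure) : (0 <= epairing D h xi)%E.
Proof. by apply: integral_ge0 => x Dx; rewrite lee_fin (hazard_ge0 Gg Dx). Qed.

Lemma departure_rate_measurable :
  measurable_fun (half_line : set (measurableTypeR R)) (fun s => epairing D h (nu s)).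
Proof.
apply: (emeasurable_fun_cvg
  (fun n s => (pairing D (fun x => Num.min (h x) n%:R) (nu s))%:E)); last first.
  by move=> s _; exact: epairing_hazard_limit.
move=> n; apply/measurable_EFinP; apply: right_continuous_measurable => t t0.
have [rc _] := fluid_nu_cadlag sol.
exact/rc/truncated_hazard_bounded_continuous.
Qed.

Lemma departure_rate_eintegrable t : 0 <= t ->
  mu.-integrable `[0, t] (fun s => epairing D h (nu s)).
Proof.
move=> t0; apply/integrableP; split.
  apply: measurable_funS departure_rate_measurable => //.
    exact: measurable_half_line.
  by move=> s /=; rewrite in_itv/= => /andP[].
have := fluid_departures_fin sol t0; apply: le_lt_trans.
rewrite /departures le_eqVlt; apply/orP; left; apply/eqP.
by apply: eq_integral => s _; rewrite gee0_abs// epairing_hazard_ge0.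
Qed.

Lemma departure_rate_ae t : 0 <= t ->
  {ae mu, forall s, `[0, t]%classic s -> epairing D h (nu s) = (rate s)%:E}.
Proof.
move=> t0; have mI : measurable (`[0, t] : set (measurableTypeR R)) by exact: measurable_itv.
have := integrable_ae mI (departure_rate_eintegrable t0).
by apply: filterS => s H st; rewrite /rate fineK//; exact: H.
Qed.

Lemma departure_rate_ae_half_line :
  {ae mu, forall s, 0 <= s -> epairing D h (nu s) = (rate s)%:E}.
Proof.
have H : {ae mu, forall s (n : nat), `[0, n%:R]%classic s -> epairing D h (nu s) = (rate s)%:E}.
  by apply/ae_foralln => n; exact: departure_rate_ae.
move: H; apply: filterS; first exact: (ae_filter_ringOfSetsType mu).
move=> s H s0; apply: (H (Num.truncn s).+1); rewrite /= in_itv/= s0.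
by apply/ltW/truncnS_gt.
Qed.

Lemma departure_rate_ge0 s : 0 <= rate s.
Proof. exact/fine_ge0/epairing_hazard_ge0. Qed.

Lemma departure_rate_measurable_on t :
  measurable_fun (`[0, t] : set (measurableTypeR R)) (EFin \o rate).
Proof.
apply/measurable_EFinP; apply: measurableT_comp => //.
apply: measurable_funS departure_rate_measurable => //.
  exact: measurable_half_line.
by move=> s /=; rewrite in_itv/= => /andP[].
Qed.

Lemma departure_rate_integral t : 0 <= t ->
  (\int[mu]_(s in `[0%R, t]) (rate s)%:E = departures D h nu t)%E.
Proof.
move=> t0; have mI : measurable (`[0, t] : set (measurableTypeR R)) by exact: measurable_itv.
apply: ae_eq_integral => //.
- exact: departure_rate_measurable_on.
- exact: (measurable_int _ (departure_rate_eintegrable t0)).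
- have := departure_rate_ae t0.
  apply: filterS; first exact: (ae_filter_ringOfSetsType mu).
  by move=> s H st; rewrite /= H.
Qed.

Lemma departure_rate_integrable t : 0 <= t -> mu.-integrable `[0, t] (EFin \o rate).
Proof.
move=> t0; apply/integrableP; split; first exact: departure_rate_measurable_on.
have := fluid_departures_fin sol t0; apply: le_lt_trans.
rewrite -departure_rate_integral// le_eqVlt; apply/orP; left; apply/eqP.
by apply: eq_integral => s _; rewrite /= ger0_norm// departure_rate_ge0.
Qed.

Lemma departures_primitive t : 0 <= t -> Dep t = \int[mu]_(s in `[0, t]) rate s.
Proof. by move=> t0; rewrite /Dep -departure_rate_integral. Qed.

Lemma departures_mono s t : 0 <= s -> s <= t -> Dep s <= Dep t.
Proof.
apply: (primitive_mono departure_rate_integrable departures_primitive).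
by move=> r _; exact: departure_rate_ge0.
Qed.

Hypothesis data : initial_data D E X0 nu0.

Lemma busy_mass t : 0 <= t -> pairing D (cst 1) (nu t) = Num.min (X t) 1.
Proof.
move=> t0; have := fluid_idle sol t0; have [H|H] := leP (1 - X t) 0 => e.
  have -> : Num.min (X t) 1 = 1 by rewrite min_r//; lra.
  lra.
have -> : Num.min (X t) 1 = X t by rewrite min_l//; lra.
lra.
Qed.

Lemma initial_mass : pairing D (cst 1) nu0 = Num.min X0 1.
Proof.
have [_ _ _] := data; have [H|H] := leP (1 - X0) 0 => e.
  have -> : Num.min X0 1 = 1 by rewrite min_r//; lra.
  lra.
have -> : Num.min X0 1 = X0 by rewrite min_l//; lra.
lra.
Qed.

Lemma entriesE t : 0 <= t -> K t = Num.min (X0 + E t - Dep t) 1 - Num.min X0 1 + Dep t.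
Proof.
by move=> t0; rewrite /K /entries busy_mass// initial_mass (fluid_X sol t0).
Qed.

(** [X] moves by the arrivals minus the departures, and [min (X, 1)] follows
    it as a non-decreasing 1-Lipschitz function of [X]. *)
Lemma entries_increment s t : 0 <= s -> s <= t ->
  0 <= K t - K s <= (E t - E s) + (Dep t - Dep s).
Proof.
move=> s0 st; have t0 := le_trans s0 st.
have [[_ _ Emono _] _ _ _] := data.
have := Emono _ _ s0 st; have := departures_mono s0 st.
rewrite !entriesE//; case: (leP (X0 + E t - Dep t) 1); case: (leP (X0 + E s - Dep s) 1) => *;
  apply/andP; split; lra.
Qed.

Lemma entries_mono s t : 0 <= s -> s <= t -> K s <= K t.
Proof. by move=> s0 st; have /andP[+ _] := entries_increment s0 st; rewrite subr_ge0. Qed.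

Lemma departures0 : Dep 0 = 0.
Proof. by rewrite /Dep /departures set_itv1 integral_set1. Qed.

Lemma entries0 : K 0 = 0.
Proof.
have [[_ _ _ E0] _ _ _] := data.
by rewrite entriesE// E0 departures0 subr0 !addr0 subrr.
Qed.

End entries.

(** * The age representation *)

Section representation.
Context {R : realType}.
Notation mu := (@lebesgue_measure R).
Notation submeasure := (subprobability (measurableTypeR R) R).

Variables (G : cumulativeBounded (0 : R) (1 : R)) (g : R -> R).
Hypothesis Gg : cdf_with_density G g.
Let D := service_itv G.
Let h := hazard G g.
Hypothesis ch : {within D, continuous h}.
Variables (E : R -> R) (X0 : R) (nu0 : submeasure).
Hypothesis data : initial_data D E X0 nu0.
Variables (X : R -> R) (nu : R -> submeasure).
Hypothesis sol : fluid_solution D h E X0 nu0 X nu.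
Let K := entries D h nu0 nu.

Let mD : measurable (D : set (measurableTypeR R)) := measurable_service_itv G.

(** The smoothed profiles [Fn] of [F = f * (1 - G)] are dominated by [B * (1 -
    G)], which is non-increasing; hence the quotients by [1 - G] at an earlier
    age stay below [B], although [1 - G] tends to 0 at the right end. *)
Lemma age_representation (f : R -> R) : bounded_continuous_on half_line f ->
  forall t, 0 <= t ->
  exists2 I : R, is_RS_integral (fun s => f (t - s) * (1 - G (t - s))) K 0 t I &
    pairing D f (nu t) =
      pairing D (fun x => f (x + t) * ((1 - G (x + t)) / (1 - G x))) nu0 + I.
Proof.
move=> [cf [B0 fB0]] t t0.
pose B := `|B0|.
have fB x : 0 <= x -> `|f x| <= B by move=> x0; apply: le_trans (fB0 x x0) (ler_norm _).
pose f1 x := f (Num.max x 0).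
have cf1 : continuous f1.
  move=> x; have max0 : 0 <= Num.max x 0 by rewrite le_max lexx orbT.
  move/subspace_continuousP : cf => /(_ _ max0) cfx.
  apply: (cvg_comp (fun x => Num.max x 0) f _ cfx).
  move=> P nP.
  have cm : {for x, continuous (fun x : R => Num.max x 0)}.
    by apply: continuous_max; [exact: cvg_id|exact: cvg_cst].
  have near_P : \forall y \near x, half_line (Num.max y 0) -> P (Num.max y 0).
    exact: cm _ nP.
  suff near_P2 : \forall y \near x, P (Num.max y 0) by exact: near_P2.
  near=> y; have : half_line (Num.max y 0) -> P (Num.max y 0) by near: y.
  by apply; rewrite /half_line /= le_max lexx orbT.
pose F x := f1 x * (1 - G x).
pose w x := B * (1 - G x).
have cF : continuous F.
  move=> x; apply: cvgM; first exact: cf1.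
  by apply: cvgB; [exact: cvg_cst|exact: (law_continuous Gg)].
have psi0 x : 0 <= 1 - G x by rewrite subr_ge0 law_le1.
have w_mono x y : x <= y -> w y <= w x.
  move=> xy; rewrite /w ler_wpM2l ?normr_ge0//.
  by rewrite lerD2l lerN2 law_mono.
have Fw x : `|F x| <= w x.
  rewrite normrM (ger0_norm (psi0 x)) ler_wpM2r// fB//.
  by rewrite le_max lexx orbT.
pose Fn n := smoothing F n.
have cFn n : continuous (Fn n).
  move=> x; apply: differentiable_continuous; apply/derivable1_diffP.
  by have [] := is_derive_smoothing cF n x.
have Fout x : 0 <= x -> ~ D x -> F x = 0.
  by move=> x0 nDx; rewrite /F (law_out x0 nDx) subrr mulr0.
(* Either [n + 1] belongs to the service interval and the ramp of the
   truncation ends there, or the interval is bounded; then [F] vanishes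
   beyond its supremum and [c] is taken within one window length of it. *)
have vanish n : exists2 c, D c & forall x, c <= x -> Fn n x = 0.
  have Ni0 : 0 < (n.+1%:R : R)^-1 by rewrite invr_gt0.
  have [DN|nDN] := pselect (D n.+1%:R).
    exists n.+1%:R => //; apply: (smoothing_vanish cF) => y cy.
    by apply: truncate_far; apply: le_trans cy; rewrite lerDl ltW.
  have hs : has_sup D.
    split; first by exists 0; exact: (service_itv0 Gg).
    exists n.+1%:R => x Dx; rewrite leNgt; apply/negP => /ltW nx.
    by apply: nDN; exact: (service_itv_down (ler0n _ _) nx Dx).
  have [c Dc cs] := sup_adherent Ni0 hs.
  exists c => //; apply: (smoothing_vanish cF) => y cy.
  rewrite /truncate Fout ?mul0r//.
    by apply: (le_trans _ cy); rewrite addr_ge0 ?(service_itv_ge0 Dc)// ltW.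
  move=> Dy; have := sup_upper_bound hs Dy; rewrite leNgt => /negP; apply.
  by apply: lt_le_trans cy; rewrite -ltrBlDr.
have idn n : exists2 I : R, is_RS_integral (fun s => Fn n (t - s)) K 0 t I &
    pairing D (fun x => Fn n x / (1 - G x)) (nu t) =
      pairing D (fun x => Fn n (x + t) / (1 - G x)) nu0 + I.
  have [c Dc Fc] := vanish n.
  have := @transport_identity _ _ _ Gg ch _ _ _ _ _ sol _ _ _ _ t0 (is_derive_smoothing cF n).
  by move/(_ _ (smoothing'_continuous cF (n := n)) Dc Fc).
have [In hIn] : exists In, forall n, is_RS_integral (fun s => Fn n (t - s)) K 0 t (In n) /\
    pairing D (fun x => Fn n x / (1 - G x)) (nu t) =
      pairing D (fun x => Fn n (x + t) / (1 - G x)) nu0 + In n.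
  exists (fun n => s2val (cid2 (idn n))) => n.
  by split; [exact: (s2valP (cid2 (idn n)))|exact: (s2valP' (cid2 (idn n)))].
have bound n x y : D x -> x <= y -> `|Fn n y / (1 - G x)| <= B.
  move=> Dx xy; have px := survival_gt0 Dx.
  rewrite normrM normfV (gtr0_norm px) ler_pdivrMr//.
  exact: le_trans (smoothing_le cF w_mono Fw n y) (w_mono _ _ xy).
have cquot n (r : R) : {within D, continuous (fun x => Fn n (x + r) / (1 - G x))}.
  have c1 : {within D, continuous (fun x => Fn n (x + r))}.
    apply: continuous_subspaceT => x.
    apply: (@continuous_comp _ _ _ (fun x => x + r) (Fn n)); last exact: cFn.
    by apply: cvgD; [exact: cvg_id|exact: cvg_cst].
  by move=> x; apply: cvgM; [exact: c1|exact: (survival_inv_within Gg)].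
have lim (r : R) (xi : submeasure) : 0 <= r ->
    pairing D (fun x => Fn n (x + r) / (1 - G x)) xi @[n --> \oo] -->
    pairing D (fun x => F (x + r) / (1 - G x)) xi.
  move=> r0; apply: (@pairing_bounded_cvg _ _ _ _ _ B) => //.
  - by move=> n x Dx; apply: bound => //; rewrite lerDl.
  - move=> x Dx; apply: cvgM; last exact: cvg_cst.
    by apply: smoothing_cvg => //; rewrite addr_ge0// (service_itv_ge0 Dx).
have lim_t := lim 0 (nu t) (lexx _).
have lim_0 := lim t nu0 t0.
have f1E x : 0 <= x -> f1 x = f x by move=> x0; rewrite /f1 max_l.
have Et : pairing D (fun x => F (x + 0) / (1 - G x)) (nu t) = pairing D f (nu t).
  apply: eq_Rintegral => x; rewrite inE => Dx.
  rewrite addr0 /F mulfK ?f1E ?(service_itv_ge0 Dx)//.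
  exact/lt0r_neq0/survival_gt0.
have E0 : pairing D (fun x => F (x + t) / (1 - G x)) nu0 =
    pairing D (fun x => f (x + t) * ((1 - G (x + t)) / (1 - G x))) nu0.
  apply: eq_Rintegral => x; rewrite inE => Dx.
  by rewrite /F mulrA f1E// addr_ge0// (service_itv_ge0 Dx).
exists (pairing D f (nu t) - pairing D (fun x => f (x + t) * ((1 - G (x + t)) / (1 - G x))) nu0);
  last by rewrite addrC subrK.
rewrite -Et -E0.
have cI : In n @[n --> \oo] --> pairing D (fun x => F (x + 0) / (1 - G x)) (nu t) -
    pairing D (fun x => F (x + t) / (1 - G x)) nu0.
  have InE : In = (fun n => pairing D (fun x => Fn n (x + 0) / (1 - G x)) (nu t) -
      pairing D (fun x => Fn n (x + t) / (1 - G x)) nu0); last first.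
    by rewrite InE; exact: (cvgB lim_t lim_0).
  apply/funext => n; have [_ e] := hIn n.
  have -> : pairing D (fun x => Fn n (x + 0) / (1 - G x)) (nu t) =
      pairing D (fun x => Fn n x / (1 - G x)) (nu t).
    by apply: eq_Rintegral => x _; rewrite addr0.
  by rewrite e addrC addKr.
have monoK : monotone_on 0 t K.
  by move=> x y x0 xy _; exact: (entries_mono Gg ch sol data x0 xy).
apply: (@eq_RS_integral _ (fun s => F (t - s)) _ K) => //.
  by move=> s /andP[s0 st]; rewrite /F f1E// subr_ge0.
apply: (@RS_integral_uniform_limit _ (fun n s => Fn n (t - s))
  _ _ _ _ In _ monoK t0 _ (fun n => (hIn n).1) cI).
move=> e e0; have := smoothing_uniform_cvg cF t e0.
apply: filterS => n H x /andP[x0 xt]; apply: H; apply/andP; split; lra.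
Unshelve. all: by end_near. Qed.

End representation.

(** * Uniqueness *)

Section uniqueness.
Context {R : realType}.
Notation submeasure := (subprobability (measurableTypeR R) R).
Variables (G : cumulativeBounded (0 : R) (1 : R)) (g : R -> R).
Hypothesis Gg : cdf_with_density G g.
Let D := service_itv G.
Let h := hazard G g.
Hypothesis ch : {within D, continuous h}.
Variables (E : R -> R) (X0 : R) (nu0 : submeasure).
Hypothesis data : initial_data D E X0 nu0.
Variables (X1 X2 : R -> R) (nu1 nu2 : R -> submeasure).
Hypothesis sol1 : fluid_solution D h E X0 nu0 X1 nu1.
Hypothesis sol2 : fluid_solution D h E X0 nu0 X2 nu2.
Let K1 := entries D h nu0 nu1.
Let K2 := entries D h nu0 nu2.
Let Dep1 t := fine (departures D h nu1 t).
Let Dep2 t := fine (departures D h nu2 t).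

(** For fixed data [K] depends on [Dep] through [min (X0 + E, 1 + Dep)], a
    1-Lipschitz function of [Dep]. *)
Lemma entries_diff_le_departures t : 0 <= t -> `|K1 t - K2 t| <= `|Dep1 t - Dep2 t|.
Proof.
move=> t0; rewrite /K1 (entriesE sol1 data t0) /K2 (entriesE sol2 data t0).
rewrite -/(Dep1 t) -/(Dep2 t).
have n1 := ler_norm (Dep1 t - Dep2 t); have n2 := ler_norm (- (Dep1 t - Dep2 t)).
rewrite normrN in n2; move: n1 n2; set N := `|Dep1 t - Dep2 t| => n1 n2.
rewrite ler_norml.
have [?|?] := leP (X0 + E t - Dep1 t) 1; have [?|?] := leP (X0 + E t - Dep2 t) 1;
  apply/andP; split; lra.
Qed.

(** In the representation with [f = 1] the initial term is common to both
    solutions, so [Dep1 - Dep2] is [K1 - K2] minus the difference of the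
    integrals of [1 - G (t - s)]; summation by parts leaves [K1 - K2]
    integrated against the increments of [1 - G (t - s)] over [[a, t]], whose
    total is [G (t - a)]. *)
Lemma departures_diff_le a t m : 0 <= a -> a <= t -> 0 <= m ->
  (forall x, 0 <= x <= t -> `|K1 x - K2 x| <= m) ->
  (forall x, 0 <= x <= a -> K1 x = K2 x) ->
  `|Dep1 t - Dep2 t| <= m * G (t - a).
Proof.
move=> a0 at_ m0 km ka; have t0 := le_trans a0 at_.
have one : bounded_continuous_on (@half_line R) (cst 1).
  split; last by exists 1 => x _; rewrite normr1.
  by apply: continuous_subspaceT => x; exact: cvg_cst.
have [I1 h1 e1] := age_representation Gg ch data sol1 one t0.
have [I2 h2 e2] := age_representation Gg ch data sol2 one t0.
have mw : monotone_on 0 t (fun s => cst 1 (t - s) * (1 - G (t - s))).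
  move=> x y x0 xy yt; rewrite /= !mul1r lerD2l lerN2; apply: law_mono; lra.
have := RS_by_parts_bound a0 at_ mw m0 km ka h1 h2.
rewrite /= subrr (law0 Gg) subr0 !mul1r.
have -> : K1 t - K2 t - (I1 - I2) = Dep1 t - Dep2 t.
  by rewrite /K1 /K2 /entries -/(Dep1 t) -/(Dep2 t) -/D e1 e2; ring.
by rewrite (_ : 1 - (1 - G (t - a)) = G (t - a)) //; ring.
Qed.

(** With [d] such that [G d <= 1 / 2], the bound on the difference of the
    entries over [[a, a + d]] is halved by each passage through the
    departures; starting from agreement at time 0, agreement spreads by steps
    of length [d]. *)
Lemma entries_unique t : 0 <= t -> K1 t = K2 t.
Proof.
have half : (0 : R) < 1 / 2 by lra.
have [d Gd] := nondecreasing_right_continuousP 0 G half.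
have {}Gd : G d%:num <= 1 / 2.
  by move: Gd; rewrite add0r => /le_trans; apply; rewrite [X in X + _](law0 Gg) add0r.
have step a : 0 <= a -> (forall x, 0 <= x <= a -> K1 x = K2 x) ->
    forall x, 0 <= x <= a + d%:num -> K1 x = K2 x.
  move=> a0 ka; have T0 : 0 <= a + d%:num by rewrite addr_ge0.
  pose m0 := K1 (a + d%:num) + K2 (a + d%:num).
  have K1x x : 0 <= x -> 0 <= K1 x.
    move=> x0; rewrite -(entries0 sol1 data); exact: (entries_mono Gg ch sol1 data (lexx 0) x0).
  have K2x x : 0 <= x -> 0 <= K2 x.
    move=> x0; rewrite -(entries0 sol2 data); exact: (entries_mono Gg ch sol2 data (lexx 0) x0).
  have m00 : 0 <= m0 by exact: addr_ge0 (K1x _ T0) (K2x _ T0).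
  have bnd n : forall x, 0 <= x <= a + d%:num -> `|K1 x - K2 x| <= m0 * (1 / 2) ^+ n.
    elim: n => [|n IH] x /andP[x0 xT].
      have := K1x x x0; have := K2x x x0.
      have : K1 x <= K1 (a + d%:num) := entries_mono Gg ch sol1 data x0 xT.
      have : K2 x <= K2 (a + d%:num) := entries_mono Gg ch sol2 data x0 xT.
      by rewrite expr0 mulr1 /m0 ler_norml => *; apply/andP; split; lra.
    have mn0 : 0 <= m0 * (1 / 2) ^+ n by rewrite mulr_ge0// exprn_ge0// ltW.
    have [xa|/ltW ax] := leP x a.
      by rewrite ka ?x0// subrr normr0 mulr_ge0// exprn_ge0// ltW.
    apply: (le_trans (entries_diff_le_departures x0)).
    apply: le_trans (departures_diff_le a0 ax mn0 _ ka) _.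
      by move=> y /andP[y0 yx]; apply: IH; rewrite y0 (le_trans yx).
    have -> : m0 * (1 / 2) ^+ n.+1 = m0 * (1 / 2) ^+ n * (1 / 2) by rewrite exprSr; ring.
    rewrite ler_wpM2l//; apply: le_trans Gd; apply: law_mono; lra.
  move=> x xT; apply/eqP; rewrite -subr_eq0 -normr_le0.
  have : m0 * (1 / 2) ^+ n @[n --> \oo] --> m0 * 0.
    by apply: cvgM; [exact: cvg_cst|apply: cvg_expr; rewrite ger0_norm; lra].
  rewrite mulr0 => H; rewrite leNgt; apply/negP => pos.
  have [n] := filter_ex (cvgr_lt _ H _ pos).
  by rewrite ltNge => /negP; apply; exact: bnd.
have all n : forall x, 0 <= x <= n%:R * d%:num -> K1 x = K2 x.
  elim: n => [|n IH] x.
    rewrite mul0r => x0; have -> : x = 0 by apply/le_anti; rewrite andbC.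
    by rewrite /K1 (entries0 sol1 data) /K2 (entries0 sol2 data).
  by rewrite -natr1 mulrDl mul1r; apply: step => //; rewrite mulr_ge0.
move=> t0; apply: (all (Num.truncn (t / d%:num)).+1); rewrite t0/=.
by rewrite -ler_pdivrMr// ltW// truncnS_gt.
Qed.

Lemma departures_unique t : 0 <= t -> Dep1 t = Dep2 t.
Proof.
move=> t0; apply/eqP; rewrite -subr_eq0 -normr_le0.
have K12 x : 0 <= x <= t -> K1 x = K2 x by move=> /andP[x0 _]; exact: entries_unique.
have := departures_diff_le t0 (lexx t) (lexx 0) _ K12.
by rewrite mul0r; apply => x xt; rewrite K12// subrr normr0.
Qed.

Lemma fluid_solution_unique t : 0 <= t ->
  X1 t = X2 t /\
  (forall A : set (measurableTypeR R), measurable A -> nu1 t A = nu2 t A).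
Proof.
move=> t0; split.
  rewrite (fluid_X sol1 t0) (fluid_X sol2 t0) -/(Dep1 t) -/(Dep2 t).
  by rewrite departures_unique.
apply: (submeasure_eq (measurable_service_itv G)).
- exact: (fluid_nu_supp sol1).
- exact: (fluid_nu_supp sol2).
move=> f bf.
have [I1 h1 ->] := age_representation Gg ch data sol1 bf t0.
have [I2 h2 ->] := age_representation Gg ch data sol2 bf t0.
congr (_ + _); apply: (RS_integral_unique t0 h1).
by apply: eq_RS_integral h2 => // x /andP[x0 _]; rewrite -/K1 -/K2 entries_unique.
Qed.

End uniqueness.

(** * The entry rate *)

Section entry_rate.
Context {R : realType}.
Notation mu := (@lebesgue_measure R).
Notation submeasure := (subprobability (measurableTypeR R) R).
Variables (G : cumulativeBounded (0 : R) (1 : R)) (g : R -> R).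
Hypothesis Gg : cdf_with_density G g.
Let D := service_itv G.
Let h := hazard G g.
Hypothesis ch : {within D, continuous h}.
Variables (E : R -> R) (X0 : R) (nu0 : submeasure).
Hypothesis data : initial_data D E X0 nu0.
Variables (X : R -> R) (nu : R -> submeasure).
Hypothesis sol : fluid_solution D h E X0 nu0 X nu.
Hypothesis acE : absolutely_continuous E.
Let K := entries D h nu0 nu.
Let Dep t := fine (departures D h nu t).
Let rate s := fine (epairing D h (nu s)).

Lemma departures_absolutely_continuous : absolutely_continuous Dep.
Proof.
exact: (primitive_absolutely_continuous
  (departure_rate_integrable Gg ch sol) (departures_primitive Gg ch sol)).
Qed.

(** The increments of [K] are at most the sum of those of [E] and [Dep]. *)
Lemma entries_absolutely_continuous : absolutely_continuous K.
Proof.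
move=> T T0 e e0; have e2 : 0 < e / 2 by rewrite divr_gt0.
have [d1 d10 h1] := acE T0 e2.
have [d2 d20 h2] := departures_absolutely_continuous T0 e2.
exists (Num.min d1 d2); first by rewrite lt_min d10.
move=> n a b ab tab; rewrite lt_min => /andP[s1 s2].
have := h1 n a b ab tab s1; have := h2 n a b ab tab s2 => H2 H1.
apply: (@le_lt_trans _ _ (\sum_(i < n) `|E (b i) - E (a i)| +
    \sum_(i < n) `|Dep (b i) - Dep (a i)|)); last first.
  by rewrite [ltRHS]splitr ltrD.
rewrite -big_split; apply: ler_sum => i _; have [a0 abi _] := ab i.
have /andP[K0 K1] := entries_increment Gg ch sol data a0 abi.
rewrite ger0_norm//; apply: le_trans K1 _.
by apply: lerD; exact: ler_norm.
Qed.

(** All derivatives exist outside a null set. Off [X = 1] the continuity of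
    [X] decides which argument of the minimum in [entriesE] is active near
    [t]. On [X = 1] Fermat's rule for [min (X, 1)] and for [min (X, 1) - X]
    forces the rates of arrival, departure and entry to coincide. *)
Lemma entry_rate : {ae mu, forall t, 0 <= t ->
  [/\ derivable E t 1, derivable K t 1,
      (X t < 1 -> derive1 K t = derive1 E t),
      (X t = 1 -> (derive1 K t)%:E = Order.min (derive1 E t)%:E (epairing D h (nu t))) &
      (1 < X t -> (derive1 K t)%:E = epairing D h (nu t))]}.
Proof.
have [[_ _ mE _] _ _ _] := data.
have aeE := absolutely_continuous_ae_derivable acE mE.
have aeK := absolutely_continuous_ae_derivable entries_absolutely_continuous
  (entries_mono Gg ch sol data).
have aeD := primitive_ae_derivable (departure_rate_integrable Gg ch sol)
  (departures_primitive Gg ch sol).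
have aer := departure_rate_ae_half_line Gg ch sol.
have ae0 : {ae mu, forall t, t != 0}.
  exists [set 0]; split => //; first exact: lebesgue_measure_set1.
  by move=> t /= /negP; rewrite negbK => /eqP.
have H : {ae mu, forall t, ((((0 < t -> derivable E t 1) /\ (0 < t -> derivable K t 1)) /\
    (0 < t -> derivable Dep t 1 /\ derive1 Dep t = rate t)) /\
    (0 <= t -> epairing D h (nu t) = (rate t)%:E)) /\ t != 0}.
  exact: (lebesgue_ae_and (lebesgue_ae_and (lebesgue_ae_and
    (lebesgue_ae_and aeE aeK) aeD) aer) ae0).
move: H; apply: filterS; first exact: (ae_filter_ringOfSetsType mu).
move=> t [[[[dE dK] dD] er] tn0] t0.
have tp : 0 < t by rewrite lt_neqAle eq_sym tn0.
have {}dE := dE tp; have {}dK := dK tp; have {dD}[dD DE] := dD tp; have {}er := er t0.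
have tge0 : \forall y \near t, 0 <= y.
  by near=> y; apply/ltW; near: y; exact: lt_nbhsr.
pose Y y := X0 + E y - Dep y.
have XY : X t = Y t by exact: (fluid_X sol t0).
have cY : {for t, continuous Y}.
  apply: cvgB; first apply: cvgD; first exact: cvg_cst.
  - exact: absolutely_continuous_continuous.
  - exact: (absolutely_continuous_continuous departures_absolutely_continuous).
have KE : \forall y \near t, K y = Num.min (Y y) 1 - Num.min X0 1 + Dep y.
  by move: tge0; apply: filterS => y y0; exact: (entriesE sol data y0).
have isE := derivable_is_derive1 dE.
have isD := derivable_is_derive1 dD; rewrite DE in isD.
have isK := derivable_is_derive1 dK.
have val f l : is_derive t 1 f l -> derive1 f t = l.
  by move=> [_ <-]; rewrite derive1E.
split; [exact: dE|exact: dK| | |].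
- move=> X1; rewrite XY in X1.
  apply: val; have isc := is_derive_cst (X0 - Num.min X0 1) t (1 : R).
  have := is_deriveD isc isE; rewrite add0r; apply: near_eq_is_derive.
  have Y1 : \forall y \near t, Y y < 1 by exact: (cvgr_lt _ cY _ X1).
  near=> y.
  have Yy : Y y < 1 by near: y.
  have -> : K y = Num.min (Y y) 1 - Num.min X0 1 + Dep y by near: y.
  transitivity (X0 - Num.min X0 1 + E y); first by [].
  by rewrite [Num.min (Y y) 1]min_l ?(ltW Yy)// /Y; ring.
- move=> X1; rewrite XY in X1.
  pose m y := K y + (Num.min X0 1 - Dep y).
  have mE' : \forall y \near t, m y = Num.min (Y y) 1.
    by near=> y; rewrite /m (near KE y)//; ring.
  have ism : is_derive t 1 m (derive1 K t - rate t).
    have isc := is_derive_cst (Num.min X0 1) t (1 : R).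
    have := is_deriveD isK (is_deriveB isc isD).
    by rewrite sub0r.
  have KD : derive1 K t - rate t = 0.
    apply: (is_derive_local_max ism); near=> y.
    by rewrite (near mE' y)// (nbhs_singleton mE') X1 minxx ge_min lexx orbT.
  have isY : is_derive t 1 (fun y => m y - Y y) (derive1 K t - rate t - (derive1 E t - rate t)).
    have isc := is_derive_cst X0 t (1 : R).
    have := is_deriveB ism (is_deriveB (is_deriveD isc isE) isD).
    by rewrite add0r.
  have ED : derive1 K t - rate t - (derive1 E t - rate t) = 0.
    apply: (is_derive_local_max isY); near=> y.
    rewrite (near mE' y)// (nbhs_singleton mE') X1 minxx subrr subr_le0.
    by rewrite ge_min lexx.
  have -> : derive1 K t = rate t by lra.
  have -> : derive1 E t = rate t by lra.
  by rewrite er minxx.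
- move=> X1; rewrite XY in X1; rewrite er; congr EFin.
  apply: val; have isc := is_derive_cst (1 - Num.min X0 1) t (1 : R).
  have := is_deriveD isc isD; rewrite add0r; apply: near_eq_is_derive.
  have Y1 : \forall y \near t, 1 < Y y by exact: (cvgr_gt _ cY _ X1).
  near=> y.
  have Yy : 1 < Y y by near: y.
  have -> : K y = Num.min (Y y) 1 - Num.min X0 1 + Dep y by near: y.
  transitivity (1 - Num.min X0 1 + Dep y); first by [].
  by rewrite [Num.min (Y y) 1]min_r ?(ltW Yy).
Unshelve. all: by end_near. Qed.

End entry_rate.

(** * Absolute continuity of the age distribution *)

Section age_absolutely_continuous.
Context {R : realType}.
Notation mu := (@lebesgue_measure R).
Notation submeasure := (subprobability (measurableTypeR R) R).

Variables (G : cumulativeBounded (0 : R) (1 : R)) (g : R -> R).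
Hypothesis Gg : cdf_with_density G g.
Let D := service_itv G.
Let h := hazard G g.
Hypothesis ch : {within D, continuous h}.
Variables (E : R -> R) (X0 : R) (nu0 : submeasure).
Hypothesis data : initial_data D E X0 nu0.
Variables (X : R -> R) (nu : R -> submeasure).
Hypothesis sol : fluid_solution D h E X0 nu0 X nu.
Hypothesis acE : absolutely_continuous E.
Let K := entries D h nu0 nu.

Let mD : measurable (D : set (measurableTypeR R)) := measurable_service_itv G.

(** The representation is applied to functions between 0 and the indicator of
    [V]: the initial term is at most the [nu0]-mass of [V] shifted by [t], the
    other term at most the variation of [K] over the reflection of [V]. *)
Lemma age_small_on_open (t e : R) : nu0 `<< mu -> 0 <= t -> 0 < e ->
  exists2 d : R, 0 < d & forall V : set (measurableTypeR R), open (V : set R) ->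
    (mu V < d%:E)%E -> (nu t (D `&` V) <= (e + e)%:E)%E.
Proof.
move=> nu0m t0 e0.
have [d1 d10 h1] := submeasure_dominated_modulus nu0m e0.
have [d2 d20 h2] := absolutely_continuous_small_cover
  (entries_absolutely_continuous Gg ch data sol acE) t0 e0.
exists (Num.min d1 d2); first by rewrite lt_min d10.
move=> V oV; rewrite EFin_min lt_min => /andP[V1 V2].
have mV : measurable V by exact: (open_measurable oV).
have V_neqT : exists x, ~ V x.
  apply: contrapT => nV; have VT : V = setT.
    by apply/seteqP; split => // x _; apply: contrapT => Vx; apply: nV; exists x.
  by move: V1; rewrite VT -set_itvNyy lebesgue_measure_itv.
pose f n := inner_bump V n.+1.
have f0 n x : 0 <= f n x := inner_bump_ge0 V _ x.
have f1 n x : f n x <= 1 := inner_bump_le1 V _ x.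
have fc n : continuous (f n) by exact: inner_bump_continuous.
have bf n : bounded_continuous_on half_line (f n).
  split; first exact: continuous_subspaceT.
  by exists 1 => x _; rewrite ger0_norm.
have bound n : pairing D (f n) (nu t) <= e + e.
  have [I hI ->] := age_representation Gg ch data sol (bf n) t0.
  apply: lerD; last first.
    apply: (@RS_integral_small _ _ K t I e n.+1%:R^-1 ((fun s => t - s) @^-1` V) t0 _ _ _ _ _ hI).
    - by rewrite invr_gt0.
    - by move=> x y x0 xy _; exact: (entries_mono Gg ch sol data x0 xy).
    - move=> s _; have p0 : 0 <= 1 - G (t - s) by rewrite subr_ge0 law_le1.
      rewrite mulr_ge0//= mulr_ile1// gerBl; exact: (law_ge0 Gg).
    - move=> s z _ fs sz; apply: (@inner_bump_ball _ V V_neqT n (t - s)).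
        by apply: contra_neq fs => fs0; rewrite /f fs0 mul0r.
      by rewrite (_ : t - s - (t - z) = - (s - z)) ?normrN//; ring.
    - apply: h2; last by rewrite lebesgue_measure_reflection.
      apply: open_measurable; apply: open_comp oV => s _.
      by apply: cvgB; [exact: cvg_cst|exact: cvg_id].
  pose W : set (measurableTypeR R) := (fun x => x + t) @^-1` V.
  have mW : measurable W.
    apply: open_measurable; apply: open_comp oV => s _.
    by apply: cvgD; [exact: cvg_id|exact: cvg_cst].
  have muW : (mu W < d1%:E)%E by rewrite /W lebesgue_measure_translation.
  have mDW : measurable (W `&` D) by exact: measurableI.
  have W_small : fine (nu0 (W `&` D)) <= e.
    rewrite -lee_fin fineK ?submeasure_fin_num//.
    by apply: le_trans (ltW (h1 _ mW muW)); apply: le_measure; rewrite ?inE.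
  apply: le_trans W_small.
  rewrite [leRHS](_ : _ = \int[nu0]_(x in D) \1_W x); last first.
    by rewrite /Rintegral integral_indic.
  have ratio01 x : D x -> 0 <= (1 - G (x + t)) / (1 - G x) <= 1.
    move=> Dx; have px := survival_gt0 Dx.
    have pt : 0 <= 1 - G (x + t) by rewrite subr_ge0 law_le1.
    rewrite (divr_ge0 pt (ltW px))/= ler_pdivrMr// mul1r lerD2l lerN2.
    by apply: law_mono; lra.
  apply: le_Rintegral => //.
  - apply: pairing_integrable => //; split; last first.
      exists 1 => x Dx; have /andP[r0 r1] := ratio01 x Dx.
      rewrite ger0_norm; first exact: (mulr_ile1 (f0 _ _) r0 (f1 _ _) r1).
      exact: (mulr_ge0 (f0 _ _) r0).
    have cshift (u : R -> R) : continuous u -> continuous (fun x => u (x + t)).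
      move=> cu x; apply: (@continuous_comp _ _ _ (fun x => x + t) u); last exact: cu.
      by apply: cvgD; [exact: cvg_id|exact: cvg_cst].
    have c1 : {within D, continuous (fun x => f n (x + t))}.
      exact/continuous_subspaceT/cshift.
    have c2 : {within D, continuous (fun x => 1 - G (x + t))}.
      apply/continuous_subspaceT => x; apply: cvgB; first exact: cvg_cst.
      exact: (cshift _ (law_continuous Gg)).
    move=> x; apply: cvgM; first exact: c1.
    by apply: cvgM; [exact: c2|exact: (survival_inv_within Gg)].
  - apply: measurable_bounded_integrable => //.
    + exact: le_lt_trans (submeasure_le1 nu0 mD) (ltry 1).
    + exists 1; split; first exact: num_real.
      move=> M M1 x _ /=; rewrite indicE normr_nat; apply: le_trans (ltW M1).
      by rewrite lern1 leq_b1.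
  - move=> x Dx; have /andP[r0 r1] := ratio01 x Dx; rewrite indicE.
    have [Vx|Vx] := pselect (V (x + t)).
      by rewrite mem_set//=; exact: (mulr_ile1 (f0 _ _) r0 (f1 _ _) r1).
    by rewrite /f inner_bump_out// mul0r ler0n.
have lim : pairing D (f n) (nu t) @[n --> \oo] --> pairing D (\1_V : R -> R) (nu t).
  apply: (@pairing_bounded_cvg _ _ _ _ _ 1) => //.
  - by move=> n; exact: continuous_subspaceT.
  - by move=> n x _; rewrite ger0_norm.
  - by move=> x _; have := inner_bump_cvg oV V_neqT (x := x); rewrite -cvg_shiftS.
have mVD : measurable (V `&` D) by exact: measurableI.
rewrite setIC -(fineK (submeasure_fin_num _ mVD)) lee_fin.
rewrite [leLHS](_ : _ = pairing D (\1_V : R -> R) (nu t)); last first.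
  by rewrite /pairing /Rintegral integral_indic.
rewrite leNgt; apply/negP => big.
have [n] := filter_ex (cvgr_gt _ lim _ big).
by rewrite ltNge bound.
Qed.

Lemma age_absolutely_continuous t : nu0 `<< mu -> 0 <= t -> nu t `<< mu.
Proof.
move=> nu0m t0; apply/null_content_dominatesP => N mN N0.
rewrite (supported_on_restrict mD (fluid_nu_supp sol t0) mN).
apply/eqP; rewrite eq_le measure_ge0 andbT.
apply/lee_addgt0Pr => e e0; rewrite add0e.
have e2 : 0 < e / 2 by rewrite divr_gt0.
have [d d0 hd] := age_small_on_open nu0m t0 e2.
have [V [oV NV muV]] := lebesgue_null_open_cover mN N0 d0.
have mV : measurable (V : set (measurableTypeR R)) by exact: open_measurable.
rewrite [e]splitr; apply: le_trans (hd V oV muV).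
by apply: le_measure; rewrite ?inE//; [exact: measurableI|exact: measurableI|exact: setIS].
Qed.

End age_absolutely_continuous.

(** * Uniqueness, representation and regularity of fluid solutions *)

Unset Implicit Arguments.
Set Strict Implicit.
Set Printing Implicit Defensive.

Theorem theorem3p4 (R : realType)
  (G : cumulativeBounded (0 : R) (1 : R)) (g : R -> R)
  (E : R -> R) (X0 : R) (nu0 : subprobability (measurableTypeR R) R) :
  let D := service_itv G in
  let h := hazard G g in
  cdf_with_density G g ->
  mean_one G ->
  initial_data D E X0 nu0 ->
  {within D, continuous h} ->
  (forall (X1 X2 : R -> R)
          (nu1 nu2 : R -> subprobability (measurableTypeR R) R),
     fluid_solution D h E X0 nu0 X1 nu1 ->
     fluid_solution D h E X0 nu0 X2 nu2 ->
     forall t, 0 <= t ->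
       X1 t = X2 t /\
       (forall A : set (measurableTypeR R), measurable A ->
          nu1 t A = nu2 t A)) /\
  (forall (X : R -> R) (nu : R -> subprobability (measurableTypeR R) R),
     fluid_solution D h E X0 nu0 X nu ->
     let K := entries D h nu0 nu in
     [/\
         (forall f : R -> R, bounded_continuous_on half_line f ->
            forall t, 0 <= t ->
            exists2 I : R,
              is_RS_integral (fun s => f (t - s) * (1 - G (t - s))) K 0 t I &
              pairing D f (nu t) =
                pairing D
                  (fun x => f (x + t) * ((1 - G (x + t)) / (1 - G x))) nu0
                + I),
         (absolutely_continuous E ->
            absolutely_continuous K /\
            {ae @lebesgue_measure R, forall t, 0 <= t ->
               [/\ derivable E t 1, derivable K t 1,
                   (X t < 1 -> derive1 K t = derive1 E t),
                   (X t = 1 ->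
                      (derive1 K t)%:E =
                        Order.min (derive1 E t)%:E (epairing D h (nu t))) &
                   (1 < X t -> (derive1 K t)%:E = epairing D h (nu t))]}) &
         (nu0 `<< @lebesgue_measure R -> absolutely_continuous E ->
            forall s, 0 <= s -> nu s `<< @lebesgue_measure R)]).
Proof.
move=> D h Gg _ data ch; split.
  move=> X1 X2 nu1 nu2 sol1 sol2 t t0.
  exact: (fluid_solution_unique Gg ch data sol1 sol2 t0).
move=> X nu sol K; split.
- move=> f bf t t0; exact: (age_representation Gg ch data sol bf t0).
- move=> acE; split; first exact: (entries_absolutely_continuous Gg ch data sol acE).
  exact: (entry_rate Gg ch data sol acE).
- move=> nu0m acE s s0; exact: (age_absolutely_continuous Gg ch data sol acE nu0m s0).
Qed.
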